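(* There exist an absolute constant $c>0$ and, for each $k$, a constant $c_1>0$ depending only on $\sqrt k$, such that the following holds. Let $A\in\mathbb{R}^{n\times n}$ be symmetric positive semidefinite with eigendecomposition $A=V\Sigma V^\top=V_1\Sigma_1V_1^\top+V_2\Sigma_2V_2^\top$, where $V=[V_1,V_2]$ is orthogonal, $V_1\in\mathbb{R}^{n\times k}$, and $\mathrm{diag}(\Sigma_1,\Sigma_2)=\mathrm{diag}(\lambda_1,\dots,\lambda_n)$ is in descending order. Let $\hat A$ be a symmetric matrix with $A-3\eta I\preceq\hat A\preceq A-\eta I$ for some $0<\eta<\frac{\lambda_k-\lambda_{k+1}}{3.5\sqrt2}$. Suppose the initial guess $U_0=[u_0^1,\dots,u_0^k]$ (orthonormal columns) satisfies, for every $i\in\{2,\dots,k\}$, $\|V_{i:n}^\top[u_0^1,\dots,u_0^{i-1}]\|\le\epsilon$ for a constant $\epsilon<\frac{\eta}{26(\lambda_1-\eta)}$. Let $U_q\in\mathbb{R}^{n\times k}$ be an orthonormal basis of the span of the $q$-th iterates $[u_q^1,\dots,u_q^k]$ of the Lazy-EPSI algorithm (described in the context) applied to $A,\hat A,U_0$. Then $$\|V_2^\top U_{q+1}\|_F\le c_0\left(\frac{3.5\sqrt2\,\lambda_k}{\lambda_k-\lambda_{k+1}}\cdot\frac{\eta}{\lambda_k}\,\|V_2^\top U_q\|_F+c_2\|V_2^\top U_q\|_F^2\right),$$ where $$c_0=1+\frac{c\,\lambda_1k\,\|V_2^\top U_q\|}{\eta},\qquad c_2=\frac{17\sqrt{2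k}\,c_1\lambda_1(\lambda_1-\lambda_n)}{(\lambda_k-\lambda_{k+1})^2}+\frac{36\lambda_1}{\eta}.$$
   Context: $\preceq$ is the Loewner order; $\|\cdot\|$ is the Euclidean norm of vectors and the spectral norm of matrices; $\|\cdot\|_F$ is the Frobenius norm; $V_{i:j}$ is the matrix consisting of columns $i$ through $j$ of $V$. Lazy-EPSI algorithm. One iteration takes vectors $u_q^1,\dots,u_q^k$ to $u_{q+1}^1,\dots,u_{q+1}^k$ as follows. (1) Orthogonalization step: let $U_q$ be an orthonormal basis of $\mathrm{span}\{u_q^1,\dots,u_q^k\}$ and $\Pi=U_qU_q^\top$; let $\hat u_{q+1}^1,\dots,\hat u_{q+1}^k$ be orthonormal eigenvectors of $\Pi A\Pi$ lying in the range of $U_q$, ordered by decreasing eigenvalue. (2) EPSI step: for $i=1,\dots,k$ successively, let $\hat\lambda_i=(\hat u_{q+1}^i)^\top A\hat u_{q+1}^i$ (Rayleigh quotient), let $\hat U_{i-1}$ be the orthonormalization of $[u_{q+1}^1,\dots,u_{q+1}^{i-1}]$ (empty for $i=1$), let $\hat\Pi_i=I-\hat U_{i-1}\hat U_{i-1}^\top$, and set $$u_{q+1}^i=\frac{(\hat\Pi_i\hat A\hat\Pi_i-\hat\lambda_iI)^{-1}(\hat\Pi_i\hat A\hat\Pi_i-A)\hat u_{q+1}^i}{\|(\hat\Pi_i\hat A\hat\Pi_i-\hat\lambda_iI)^{-1}(\hat\Pi_i\hat A\hat\Pi_i-A)\hat u_{q+1}^i\|}.$$ The inverses are assumed to exist.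 *)

(* Defs.v *)
From HB Require Import structures.
From mathcomp Require Import all_boot all_order all_algebra.
From mathcomp Require Import boolp classical_sets reals.

Set Implicit Arguments.
Unset Strict Implicit.
Unset Printing Implicit Defensive.

Import Order.TTheory GRing.Theory Num.Theory.
Local Open Scope ring_scope.

(* The norm [`|M|] that MathComp-Analysis puts on matrices is the entrywise
   maximum, hence the three norms below. *)

Definition vnorm2 (R : realType) (n : nat) (x : 'cV[R]_n) : R :=
  Num.sqrt (\sum_i x i 0 ^+ 2).

Definition specnorm (R : realType) (m n : nat) (M : 'M[R]_(m, n)) : R :=
  sup [set vnorm2 (M *m x) | x in [set x : 'cV[R]_n | vnorm2 x <= 1]]%classic.

Definition frobnorm (R : realType) (m n : nat) (M : 'M[R]_(m, n)) : R :=
  Num.sqrt (\sum_i \sum_j M i j ^+ 2).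

Definition psdmx (R : realType) (n : nat) (M : 'M[R]_n) : Prop :=
  M^T = M /\ forall x : 'cV[R]_n, 0 <= (x^T *m M *m x) 0 0.

(* Loewner order *)
Definition loewner (R : realType) (n : nat) (M N : 'M[R]_n) : Prop :=
  psdmx (N - M).

(* V_{i:j}: columns i through j of V, columns being numbered from 1; the column
   with ordinal index l has number l.+1.  It has no column when j < i. *)
Definition cols (R : realType) (m n : nat) (V : 'M[R]_(m, n)) (i j : nat) :
    'M[R]_(m, #|[pred l : 'I_n | (i <= l.+1 <= j)%N]|) :=
  colsub (fun s => enum_val s) V.

Definition orthonormal_cols (R : realType) (n k : nat) (U : 'M[R]_(n, k)) :
    Prop :=
  U^T *m U = 1%:M.

(* The columns of U form an orthonormal basis of the span of the columns of W.
   MathComp compares row spaces, whence the transpositions. *)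
Definition orthonormal_basis (R : realType) (n r k : nat)
    (U : 'M[R]_(n, r)) (W : 'M[R]_(n, k)) : Prop :=
  orthonormal_cols U /\ (U^T == W^T)%MS.

Definition ortho_step (R : realType) (n k : nat) (A : 'M[R]_n)
    (u uhat : 'M[R]_(n, k)) : Prop :=
  exists U : 'M[R]_(n, k),
    let P := U *m U^T in
    [/\ orthonormal_basis U u,
        orthonormal_cols uhat,
        (uhat^T <= U^T)%MS
      & exists mu : 'I_k -> R,
          (forall i j : 'I_k, (i <= j)%N -> mu j <= mu i) /\
          (forall i : 'I_k,
             P *m A *m P *m col i uhat = mu i *: col i uhat)].

(* The index i : 'I_k is the vector number i.+1, so the vectors already computed
   in the current sweep are the columns 1 to i of u'.  The number r of columns
   of Uhat is the dimension of their span (r = 0 for the first vector). *)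
Definition epsi_step (R : realType) (n k : nat) (A Ahat : 'M[R]_n)
    (uhat u' : 'M[R]_(n, k)) : Prop :=
  forall i : 'I_k,
    exists (r : nat) (Uhat : 'M[R]_(n, r)),
      let uhi := col i uhat in
      let lamhat := (uhi^T *m A *m uhi) 0 0 in
      let P := 1%:M - Uhat *m Uhat^T in
      let M := P *m Ahat *m P in
      let w := invmx (M - lamhat%:M) *m (M - A) *m uhi in
      [/\ orthonormal_basis Uhat (cols u' 1 i),
          M - lamhat%:M \in unitmx
        & col i u' = (vnorm2 w)^-1 *: w].

(* One iteration, as a relation because orthonormal bases and orthonormal
   eigenvectors are not unique.  Column i of u is the i-th iterate vector. *)
Definition lazy_epsi_iter (R : realType) (n k : nat) (A Ahat : 'M[R]_n)
    (u u' : 'M[R]_(n, k)) : Prop :=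
  exists uhat : 'M[R]_(n, k), ortho_step A u uhat /\ epsi_step A Ahat uhat u'.

(* Main.v *)
Require Import Defs.
From HB Require Import structures.
From mathcomp Require Import all_boot all_order all_algebra.
From mathcomp Require Import boolp classical_sets reals.
From mathcomp Require Import ring lra.

Set Implicit Arguments.
Unset Strict Implicit.
Unset Printing Implicit Defensive.

Import Order.TTheory GRing.Theory Num.Theory.
Local Open Scope ring_scope.

(* Let (lh_i, uh_i) be the Ritz pairs, E = A - Ahat (so eta <= E <= 3 eta) and P_i the projection that deflates u'_1, ..., u'_{i-1}.
   Modulo these vectors, the i-th new iterate is h_i = uh_i + z_i with z_i in the
   range of P_i and
     y^T ((lh_i - A) h_i + E z_i) = 0   for all y in the range of P_i.
   In particular h_l^T A y = z_l^T E y if y is orthogonal to h_1, ..., h_l: the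
   new vectors are nearly A-invariant without any gap between lambda_1, ...,
   lambda_k.  Together with Ky Fan's inequality for the Ritz space this gives
   y^T A y <= (lh_i + small) |y|^2 on the range of P_i.  Splitting the equation
   along V_1 and V_2, one gets
     |E z_i|^2 <= 3 eta z_i^T E z_i <= 3 eta |E z_i| |V_2^T uh_i| + higher order
   and gap |V_2^T h_i| <= |E z_i| + higher order, whence the linear rate
   3 eta / gap up to corrections, and an induction on i keeps the l^2 sums of the
   |z_i| and of the |V_2^T h_i| under control.  All this requires |V_2^T U_q|_F to
   be small; otherwise the right-hand side is at least sqrt k, a trivial bound. *)

(** The deflation uses computed vectors, not eigenvectors, so step i inherits the errors of all
    earlier steps, and adding them one by one would cost powers of k. Beyond the a priori bounds [B]
    and [F], they enter step i only through the numbers [dot (uh i) (z l)] and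
    [dot (uh i) (E *m z l)] with l < i. As the [uh i] are orthonormal, Bessel's inequality bounds
    the sum of the squares over all i and l by that of the |z_l|^2 or |E z_l|^2, so the bounds do
    not grow along the sweep. The margin between the ideal rate 3 and the allowed 7/2 sqrt 2 > 4.9
    (in units of eta / gap) is spent as follows: 3 becomes 7/2 for the corrections within one step,
    9/2 for the feedback of earlier steps, 47/10 for the change of basis and of gap. There is no
    room to bound |z_i| first and then |E z_i| by 3 |z_i|, which would give 9; this is why the
    estimates are written for |E z_i|. *)

Lemma eq_ler (R : realType) (x y : R) : x = y -> x <= y.
Proof. by move=> ->. Qed.

(** * Inner product, Euclidean norm and Cauchy-Schwarz inequalities *)

Section Dot.
Variables (R : realType) (n : nat).
Implicit Types (x y z : 'cV[R]_n) (M : 'M[R]_n).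

Definition dot x y : R := (x^T *m y) 0 0.

Lemma dotE x y : dot x y = \sum_i x i 0 * y i 0.
Proof. by rewrite /dot mxE; apply: eq_bigr => i _; rewrite mxE. Qed.

Lemma dotC x y : dot x y = dot y x.
Proof. by rewrite !dotE; apply: eq_bigr => i _; rewrite mulrC. Qed.

Lemma dotDr x y z : dot x (y + z) = dot x y + dot x z.
Proof. by rewrite /dot mulmxDr mxE. Qed.

Lemma dotDl x y z : dot (y + z) x = dot y x + dot z x.
Proof. by rewrite dotC dotDr !(dotC x). Qed.

Lemma dotZr a x y : dot x (a *: y) = a * dot x y.
Proof. by rewrite /dot -scalemxAr mxE. Qed.

Lemma dotZl a x y : dot (a *: x) y = a * dot x y.
Proof. by rewrite dotC dotZr dotC. Qed.

Lemma dotNr x y : dot x (- y) = - dot x y.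
Proof. by rewrite /dot mulmxN mxE. Qed.

Lemma dotNl x y : dot (- x) y = - dot x y.
Proof. by rewrite dotC dotNr dotC. Qed.

Lemma dotBr x y z : dot x (y - z) = dot x y - dot x z.
Proof. by rewrite dotDr dotNr. Qed.

Lemma dotBl x y z : dot (y - z) x = dot y x - dot z x.
Proof. by rewrite dotDl dotNl. Qed.

Lemma dot0r x : dot x 0 = 0.
Proof. by rewrite /dot mulmx0 mxE. Qed.

Lemma dot0l x : dot 0 x = 0.
Proof. by rewrite dotC dot0r. Qed.

Lemma dot_sumr I (r : seq I) (P : pred I) x (f : I -> 'cV[R]_n) :
  dot x (\sum_(i <- r | P i) f i) = \sum_(i <- r | P i) dot x (f i).
Proof. by apply: (big_morph (dot x)) => [a b|]; rewrite ?dotDr ?dot0r. Qed.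

Lemma dot_suml I (r : seq I) (P : pred I) x (f : I -> 'cV[R]_n) :
  dot (\sum_(i <- r | P i) f i) x = \sum_(i <- r | P i) dot (f i) x.
Proof. by rewrite dotC dot_sumr; apply: eq_bigr => i _; rewrite dotC. Qed.

Definition dotZ := (dotZl, dotZr).
Definition dotlin :=
  (dotDl, dotDr, dotBl, dotBr, dotNl, dotNr, dotZl, dotZr, dot0l, dot0r).

Lemma dotM M x y : dot x (M *m y) = dot (M^T *m x) y.
Proof. by rewrite /dot trmx_mul trmxK mulmxA. Qed.

Lemma dot_symM M x y : M^T = M -> dot x (M *m y) = dot (M *m x) y.
Proof. by move=> e; rewrite dotM e. Qed.

Lemma dot_symMC M x y : M^T = M -> dot x (M *m y) = dot y (M *m x).
Proof. by move=> e; rewrite dot_symM // dotC. Qed.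

Lemma dot_ge0 x : 0 <= dot x x.
Proof. by rewrite dotE; apply: sumr_ge0 => i _; rewrite -expr2 sqr_ge0. Qed.

Lemma dot_eq0 x : dot x x = 0 -> x = 0.
Proof.
rewrite dotE => /psumr_eq0P H; apply/matrixP => i j; rewrite (ord1 j) mxE.
have := H (fun i _ => _) i isT; rewrite -expr2 => /(_ (fun i => _)) e.
by apply/eqP; rewrite -(sqrf_eq0 (x i 0)) e // => l; rewrite -expr2 sqr_ge0.
Qed.

Definition nrm x : R := vnorm2 x.

Lemma nrmE x : nrm x = Num.sqrt (dot x x).
Proof. by rewrite /nrm /vnorm2 dotE. Qed.

Lemma nrm_ge0 x : 0 <= nrm x.
Proof. by rewrite nrmE sqrtr_ge0. Qed.

Lemma sqr_nrm x : nrm x ^+ 2 = dot x x.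
Proof. by rewrite nrmE sqr_sqrtr // dot_ge0. Qed.

Lemma psd_cauchy_schwarz M x y : M^T = M -> (forall z, 0 <= dot z (M *m z)) ->
  dot x (M *m y) ^+ 2 <= dot x (M *m x) * dot y (M *m y).
Proof.
move=> sM pM; set a := dot x (M *m x); set b := dot x (M *m y); set c := dot y _.
have form s t : 0 <= s ^+ 2 * a + 2 * s * t * b + t ^+ 2 * c.
  have := pM (s *: x + t *: y).
  rewrite mulmxDr -!scalemxAr !dotlin (dot_symMC y x sM) -/a -/b -/c.
  by congr (_ <= _); ring.
have a0 : 0 <= a by exact: pM.
have c0 : 0 <= c by exact: pM.
have [c00|c00] := eqVneq c 0.
  (* Degenerate case: this choice of [s] and [t] turns the form into - b^2. *)
  have := form (b) (- (a + 1) / 2); rewrite c00 mulr0 addr0.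
  have -> : b ^+ 2 * a + 2 * b * (- (a + 1) / 2) * b = - b ^+ 2 by field.
  by rewrite oppr_ge0 mulr0.
have cp : 0 < c by rewrite lt_def c00.
have := form c (- b).
have -> : c ^+ 2 * a + 2 * c * - b * b + (- b) ^+ 2 * c
  = c * (a * c - b ^+ 2) by ring.
by rewrite pmulr_rge0 // subr_ge0.
Qed.

Lemma dot_sqr_le x y : dot x y ^+ 2 <= dot x x * dot y y.
Proof.
have := @psd_cauchy_schwarz 1%:M x y; rewrite !mul1mx; apply.
  by rewrite trmx1.
by move=> z; rewrite mul1mx dot_ge0.
Qed.

Lemma abs_dot_le x y : `|dot x y| <= nrm x * nrm y.
Proof.
rewrite -ler_sqr ?nnegrE ?mulr_ge0 ?nrm_ge0 // real_normK ?num_real //.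
by rewrite exprMn !sqr_nrm dot_sqr_le.
Qed.

Lemma dot_le x y : dot x y <= nrm x * nrm y.
Proof. exact: le_trans (ler_norm _) (abs_dot_le _ _). Qed.

Lemma dot_ge x y : - (nrm x * nrm y) <= dot x y.
Proof. by have := abs_dot_le x y; rewrite ler_norml => /andP[]. Qed.

Lemma nrm_le x a : 0 <= a -> dot x x <= a ^+ 2 -> nrm x <= a.
Proof. by move=> a0; rewrite -sqr_nrm ler_sqr ?nnegrE ?nrm_ge0. Qed.

Lemma ler_nrmD x y : nrm (x + y) <= nrm x + nrm y.
Proof.
apply: nrm_le; first by rewrite addr_ge0 ?nrm_ge0.
rewrite !dotlin (dotC y x) sqrrD !sqr_nrm; have := dot_le x y.
by move=> ?; nra.
Qed.

Lemma nrmN x : nrm (- x) = nrm x.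
Proof. by rewrite !nrmE !dotlin opprK. Qed.

Lemma ler_nrmB x y : nrm (x - y) <= nrm x + nrm y.
Proof. by rewrite -(nrmN y) ler_nrmD. Qed.

Lemma nrmZ a x : nrm (a *: x) = `|a| * nrm x.
Proof.
rewrite !nrmE !dotZ mulrA -expr2 sqrtrM ?sqr_ge0 // sqrtr_sqr //.
Qed.

Lemma nrm0 : nrm 0 = 0.
Proof. by rewrite nrmE dot0r sqrtr0. Qed.

Lemma psd_abs_le M x y c : M^T = M ->
  (forall z, 0 <= dot z (M *m z) <= c * dot z z) ->
  `|dot x (M *m y)| <= c * (nrm x * nrm y).
Proof.
move=> sM pM.
have p z : 0 <= dot z (M *m z) by case/andP: (pM z).
have b z : dot z (M *m z) <= c * dot z z by case/andP: (pM z).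
have [->|x0] := eqVneq x 0; first by rewrite dot0l nrm0 normr0 mul0r mulr0.
have xx : 0 < dot x x.
  by rewrite lt_def dot_ge0 andbT; apply: contra_neq x0; exact: dot_eq0.
have c0 : 0 <= c by rewrite -(pmulr_lge0 _ xx) (le_trans (p x)).
rewrite -ler_sqr ?nnegrE ?mulr_ge0 ?nrm_ge0 // real_normK ?num_real //.
apply: le_trans (psd_cauchy_schwarz _ _ sM p) _.
rewrite !exprMn !sqr_nrm expr2 mulrACA.
by apply: ler_pM; rewrite ?p ?b.
Qed.

End Dot.

(** * Euclidean sums over subsets of the indices *)

Section EuclideanSum.
Variables (R : realType) (k : nat).
Implicit Types (P : pred 'I_k) (a b c : 'I_k -> R).

Definition l2 P a : R := Num.sqrt (\sum_(i | P i) a i ^+ 2).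

Lemma l2_ge0 P a : 0 <= l2 P a.
Proof. exact: sqrtr_ge0. Qed.

Lemma sqr_l2 P a : l2 P a ^+ 2 = \sum_(i | P i) a i ^+ 2.
Proof. by rewrite sqr_sqrtr // sumr_ge0 // => i _; rewrite sqr_ge0. Qed.

Lemma l2_nrm P a : l2 P a = nrm (\col_i (if P i then a i else 0)).
Proof.
rewrite nrmE dotE /l2; congr Num.sqrt; rewrite big_mkcond; apply: eq_bigr => i _.
by rewrite mxE; case: (P i); rewrite ?mulr0 // expr2.
Qed.

Lemma l2_le P a (c : R) : 0 <= c -> \sum_(i | P i) a i ^+ 2 <= c ^+ 2 -> l2 P a <= c.
Proof. by move=> c0; rewrite -sqr_l2 ler_sqr ?nnegrE ?l2_ge0. Qed.

Lemma l2_sum_le P a b :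
  `|\sum_(i | P i) a i * b i| <= l2 P a * l2 P b.
Proof.
rewrite !l2_nrm; apply: le_trans (abs_dot_le _ _).
rewrite dotE big_mkcond /=; apply: eq_ler; congr `|_|; apply: eq_bigr => i _.
by rewrite !mxE; case: (P i); rewrite ?mulr0.
Qed.

Lemma l2D P a b : l2 P (fun i => a i + b i) <= l2 P a + l2 P b.
Proof.
rewrite !l2_nrm; apply: le_trans (ler_nrmD _ _); apply: eq_ler.
by congr nrm; apply/matrixP => i j; rewrite !mxE; case: (P i); rewrite ?addr0.
Qed.

Lemma l2Z P a t : 0 <= t -> l2 P (fun i => t * a i) = t * l2 P a.
Proof.
move=> t0; rewrite !l2_nrm -[t in RHS]ger0_norm // -nrmZ.
by congr nrm; apply/matrixP => i j; rewrite !mxE; case: (P i); rewrite ?mulr0.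
Qed.

Lemma le_l2 P a b : (forall i, P i -> 0 <= a i <= b i) -> l2 P a <= l2 P b.
Proof.
move=> H; apply: l2_le (l2_ge0 _ _) _; rewrite sqr_l2; apply: ler_sum => i Pi.
by case/andP: (H i Pi) => a0 ab; rewrite ler_sqr ?nnegrE // (le_trans a0).
Qed.

Lemma l2_sub P (Q : pred 'I_k) a : (forall i, P i -> Q i) -> l2 P a <= l2 Q a.
Proof.
move=> H; apply: l2_le (l2_ge0 _ _) _; rewrite sqr_l2.
rewrite [leRHS](bigID P) /= -[leLHS]addr0; apply: lerD.
  rewrite [leRHS](eq_bigl P) // => i.
  by case Pi: (P i); rewrite ?andbT ?andbF // H.
by apply: sumr_ge0 => i _; rewrite sqr_ge0.
Qed.

Variable n : nat.
Implicit Type z : 'I_k -> 'cV[R]_n.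

(** The operator norm of the matrix with columns [z i] is at most its Frobenius norm; the proof
    pairs the combination with itself. *)
Lemma nrm_comb_le P c z :
  nrm (\sum_(i | P i) c i *: z i) <= l2 P c * l2 P (fun i => nrm (z i)).
Proof.
set v := \sum_(_ | _) _.
have [->|v0] := eqVneq (nrm v) 0; first by rewrite mulr_ge0 ?l2_ge0.
have vp : 0 < nrm v by rewrite lt_def v0 nrm_ge0.
rewrite -(ler_pM2r vp) -expr2 sqr_nrm {1}/v dot_suml.
apply: le_trans (ler_norm _) _.
have -> : \sum_(i | P i) dot (c i *: z i) v = \sum_(i | P i) c i * dot (z i) v.
  by apply: eq_bigr => i _; rewrite dotZl.
apply: le_trans (l2_sum_le _ _ _) _; rewrite -mulrA.
apply: ler_wpM2l; first exact: l2_ge0.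
rewrite mulrC -(l2Z _ _ (nrm_ge0 v)).
apply: l2_le (l2_ge0 _ _) _; rewrite sqr_l2; apply: ler_sum => i _.
by rewrite exprMn !sqr_nrm mulrC dot_sqr_le.
Qed.

End EuclideanSum.

Tactic Notation "lraw" hyp_list(l) := clear - l; lra.

(** * Perturbation analysis of one sweep *)

(** Real-number part of [step_bound], with X = |E z_i|, b = |J uh_i|, p = |J w|, zn = |z_i|, jz = |J
    z_i|, zEz = z_i^T E z_i. By contradiction: if X exceeds the bound, then t, t' <= 20 X and b <=
    2/7 X, so every correction is a small multiple of X^2 or of the surplus (X - 7/2 b) X, and X^2
    <= 3 zEz fails. Without corrections the result would be X <= 3 b; the extra 1/2 pays for
    them. *)
Lemma step_scalar (R : realType) (X b t t' p zn jz om F gp B zEz Xi : R) :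
  0 <= X -> 0 <= b -> 0 <= t -> 0 <= t' -> 0 <= p -> 0 <= jz ->
  0 <= om -> 0 <= F -> 0 <= B -> 4 <= gp -> F <= 1 / 10 ^+ 4 ->
  B <= 1 / 10 ^+ 4 -> om * F <= gp / 10 ^+ 4 -> om * F ^+ 2 <= 1 / 10 ^+ 5 ->
  0 <= zn <= X -> X ^+ 2 <= 3 * zEz ->
  Xi = (X + t' + 2 * t) / 5 / 10 ^+ 3 ->
  p * gp <= X + Xi ->
  jz <= p + 101 / 100 * F * t + b ->
  zEz <= p * Xi + 101 / 100 * F * t * X + b * X
    + zn * (Xi + 101 / 100 * om * F * b)
    + zn ^+ 2 / 10 ^+ 3 + 101 / 100 * B * t * X
    + 101 / 100 * om * F * t * jz ->
  X <= 7 / 2 * b + 60 * (om * F * b) + (t + t') / 20.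
Proof.
move=> X0 b0 t0 t'0 p0 jz0 om0 F0 B0 gp4 Fs Bs omFs omF2s /andP[zn0 znX] X2
  XiE pg jzle H.
rewrite leNgt; apply/negP => lt.
have omF0 : 0 <= om * F by rewrite mulr_ge0.
pose th := om * F * b.
have th0 : 0 <= th by rewrite mulr_ge0.
rewrite -/th in lt.
have t50 : t <= 20 * X by lraw lt b0 th0 t'0.
have t'50 : t' <= 20 * X by lraw lt b0 th0 t0.
have Xi0 : 0 <= Xi by rewrite XiE; lraw X0 t0 t'0.
have XiX : Xi <= 61 / 5 / 10 ^+ 3 * X by rewrite XiE; lraw t50 t'50.
have XiX' : Xi <= 1 / 80 * X by lraw XiX X0.
have p4 : p * 4 <= p * gp by rewrite ler_wpM2l.
have a2 : p * gp <= 5 / 4 * X by lraw pg XiX' X0.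
have pX : p <= 5 / 16 * X by lraw p4 a2.
pose XX := X * X.
have XX0 : 0 <= XX by rewrite mulr_ge0.
have e1 : p * Xi <= 1 / 256 * XX.
  have := ler_pM p0 Xi0 pX XiX'; rewrite /XX => k1; lraw k1.
have e2 : F * t * X <= 1 / 500 * XX.
  have a := ler_pM F0 t0 Fs t50.
  have k1 := ler_wpM2r X0 a; rewrite /XX; lraw k1.
have e3 : zn * Xi <= 1 / 80 * XX.
  have k1 := ler_pM zn0 Xi0 znX XiX'; rewrite /XX; lraw k1.
have e4 : zn * th <= X * th by rewrite ler_wpM2r.
have e5 : zn ^+ 2 <= XX by rewrite expr2 ler_pM.
have e6 : B * t * X <= 1 / 500 * XX.
  have a := ler_pM B0 t0 Bs t50.
  have k1 := ler_wpM2r X0 a; rewrite /XX; lraw k1.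
have e7 : om * F * t * p <= 1 / 400 * XX.
  have a := ler_wpM2r (mulr_ge0 t0 p0) omFs.
  have a3 : t * (p * gp) <= 20 * X * (5 / 4 * X).
    apply: ler_pM => //; rewrite mulr_ge0 //; lraw gp4.
  have -> : om * F * t * p = om * F * (t * p) by ring.
  apply: le_trans a _.
  have -> : gp / 10 ^+ 4 * (t * p) = t * (p * gp) / 10 ^+ 4 by ring.
  rewrite /XX; lraw a3.
have e8 : om * F ^+ 2 * (t * t) <= 1 / 250 * XX.
  have a1 : t * t <= 20 * X * (20 * X) by rewrite ler_pM.
  have b2 : 0 <= om * F ^+ 2 by rewrite mulr_ge0 // exprn_ge0.
  have k1 := ler_pM b2 (mulr_ge0 t0 t0) omF2s a1; rewrite /XX; lraw k1.
(* Arithmetic-geometric mean for 60 th and t / 20, with 12 = 4 * 60 / 20. The bound by the surplus X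
   - 7/2 b instead of X matters when b is close to 2/7 X and the main term leaves little room. *)
have e9 : th * t <= 1 / 12 * ((X - 7 / 2 * b) * X).
  have u0 : 60 * th + t / 20 <= X - 7 / 2 * b by lraw lt t'0.
  have u1 : X - 7 / 2 * b <= X by lraw b0.
  have u2 : 0 <= 60 * th + t / 20 by lraw th0 t0.
  have u3 : 0 <= (60 * th - t / 20) ^+ 2 by rewrite sqr_ge0.
  have u4 : (60 * th + t / 20) * (60 * th + t / 20) <= (X - 7 / 2 * b) * X.
    by apply: ler_pM => //; lraw u0 u1.
  have u5 : (60 * th + t / 20) * (60 * th + t / 20) =
    (60 * th - t / 20) ^+ 2 + 12 * (th * t) by field.
  rewrite u5 in u4; move: u3 u4; move: ((60 * th - t / 20) ^+ 2) => v u3 u4.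
  lraw u3 u4.
have e10 : th * X <= 1 / 60 * ((X - 7 / 2 * b) * X).
  have a : th <= 1 / 60 * (X - 7 / 2 * b) by lraw lt t0 t'0.
  have k1 := ler_wpM2r X0 a; lraw k1.
have e11 : om * F * t * jz <= om * F * t * p
  + 101 / 100 * (om * F ^+ 2 * (t * t)) + th * t.
  have a : 0 <= om * F * t by rewrite mulr_ge0.
  have k1 := ler_wpM2l a jzle; rewrite /th; lraw k1.
have bX : b * X <= 2 / 7 * XX.
  have a : b <= 2 / 7 * X by lraw lt th0 t0 t'0.
  have k1 := ler_wpM2r X0 a; rewrite /XX; lraw k1.
have Xp : 0 < X by apply: le_lt_trans lt; lraw b0 th0 t0 t'0.
have XXp : 0 < XX by rewrite mulr_gt0.
have H' : zEz <= p * Xi + 101 / 100 * (F * t * X) + b * X + zn * Xi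
  + 101 / 100 * (zn * th) + zn ^+ 2 / 10 ^+ 3 + 101 / 100 * (B * t * X)
  + 101 / 100 * (om * F * t * jz).
  by apply: le_trans H _; rewrite /th; lraw om0.
have X2' : XX <= 3 * zEz by rewrite /XX -expr2.
have e9' : th * t <= 1 / 12 * XX - 7 / 24 * (b * X) by rewrite /XX; lraw e9.
have e10' : X * th <= 1 / 60 * XX - 7 / 120 * (b * X) by rewrite /XX; lraw e10.
clear - e1 e2 e3 e4 e5 e6 e7 e8 e9' e10' e11 bX XXp H' X2'.
move: (p * Xi) (F * t * X) (zn * Xi) (zn * th) (X * th) (B * t * X)
  (om * F * t * p) (om * F ^+ 2 * (t * t)) (th * t) (om * F * t * jz) (b * X)
  (zn ^+ 2) XX e1 e2 e3 e4 e5 e6 e7 e8 e9' e10' e11 bX XXp H' X2' => *.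
lra.
Qed.

Section Sweep.
Variables (R : realType) (n k : nat) (A E J : 'M[R]_n).
Variables (uh z : 'I_k -> 'cV[R]_n) (lh : 'I_k -> R) (F L om gp B : R).

Definition hvec i : 'cV[R]_n := uh i + z i.
Definition resid i : 'cV[R]_n := A *m uh i - lh i *: uh i.
Definition below (i : nat) : pred 'I_k := fun l => (l < i)%N.
Definition perp (i : nat) (y : 'cV[R]_n) :=
  forall l : 'I_k, (l < i)%N -> dot (hvec l) y = 0.

(* One EPSI sweep with [eta] normalised to 1: [E] is [A - Ahat], [J] is the
   projection [V2 V2^T], [uh] and [lh] are the Ritz vectors and values, and
   [hvec i = uh i + z i] spans, together with the previous new iterates, the
   same space as the [i]-th new iterate does. *)
Record sweep : Prop := Sweep {
  sweep_A_sym : A^T = A;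
  sweep_E_sym : E^T = E;
  sweep_J_sym : J^T = J;
  sweep_J_idem : J *m J = J;
  sweep_AJ : A *m J = J *m A;
  sweep_A_bd : forall y, 0 <= dot y (A *m y) <= L * dot y y;
  sweep_E_bd : forall y, dot y y <= dot y (E *m y) <= 3 * dot y y;
  sweep_J_bd : forall i y, J *m y = y ->
  gp * dot y y <= lh i * dot y y - dot y (A *m y) <= om * dot y y;
  sweep_uh_on : forall i j, dot (uh i) (uh j) = (i == j)%:R;
  sweep_r_perp : forall i j, dot (uh i) (resid j) = 0;
  sweep_r_bd : forall i,
  nrm (resid i - J *m resid i) <= 101 / 100 * om * F * nrm (J *m uh i);
  sweep_lh_dec : forall i j : 'I_k, (i <= j)%N -> lh j <= lh i;
  sweep_lh_bd : forall i, 0 <= lh i <= L;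
  sweep_uh_rayleigh : forall (i : 'I_k) y,
  (forall l : 'I_k, (l < i)%N -> dot (uh l) y = 0) ->
  dot y (A *m y) <= (lh i + om * F ^+ 2) * dot y y;
  sweep_uh_F : l2 predT (fun i => nrm (J *m uh i)) <= F;
  sweep_z_perp : forall i : 'I_k, perp i (z i);
  sweep_z_eq : forall (i : 'I_k) y, perp i y ->
  lh i * dot y (hvec i) - dot y (A *m hvec i) + dot y (E *m z i) = 0;
  sweep_h_proj : forall (i : 'I_k) (x : 'cV[R]_n), exists c : 'I_k -> R,
  perp i (x - \sum_(l | below i l) c l *: hvec l);
  sweep_F_ge0 : 0 <= F;
  sweep_om_ge0 : 0 <= om;
  sweep_L_ge0 : 0 <= L;
  sweep_gp_ge : 24 / 5 <= gp;
  sweep_BE : B = 9 / 2 * F + 75 * (om * F ^+ 2);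
  sweep_F_small : F <= 1 / 10 ^+ 4;
  sweep_B_small : B <= 1 / 10 ^+ 4;
  sweep_LF2_small : L * F ^+ 2 <= 1 / 10 ^+ 4;
  sweep_LB4_small : L * B ^+ 4 <= 1 / 10 ^+ 4;
  sweep_omF_small : om * F <= gp / 10 ^+ 4;
  sweep_omF2_small : om * F ^+ 2 <= 1 / 10 ^+ 5
}.

Hypothesis hyps : sweep.
Local Notation A_sym := (sweep_A_sym hyps).
Local Notation E_sym := (sweep_E_sym hyps).
Local Notation J_sym := (sweep_J_sym hyps).
Local Notation J_idem := (sweep_J_idem hyps).
Local Notation AJ := (sweep_AJ hyps).
Local Notation A_bd := (sweep_A_bd hyps).
Local Notation E_bd := (sweep_E_bd hyps).
Local Notation J_bd := (sweep_J_bd hyps).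
Local Notation uh_on := (sweep_uh_on hyps).
Local Notation r_perp := (sweep_r_perp hyps).
Local Notation r_bd := (sweep_r_bd hyps).
Local Notation lh_dec := (sweep_lh_dec hyps).
Local Notation lh_bd := (sweep_lh_bd hyps).
Local Notation uh_rayleigh := (sweep_uh_rayleigh hyps).
Local Notation uh_F := (sweep_uh_F hyps).
Local Notation z_perp := (sweep_z_perp hyps).
Local Notation z_eq := (sweep_z_eq hyps).
Local Notation h_proj := (sweep_h_proj hyps).
Local Notation F_ge0 := (sweep_F_ge0 hyps).
Local Notation om_ge0 := (sweep_om_ge0 hyps).
Local Notation L_ge0 := (sweep_L_ge0 hyps).
Local Notation gp_ge := (sweep_gp_ge hyps).
Local Notation BE := (sweep_BE hyps).
Local Notation F_small := (sweep_F_small hyps).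
Local Notation B_small := (sweep_B_small hyps).
Local Notation LF2_small := (sweep_LF2_small hyps).
Local Notation LB4_small := (sweep_LB4_small hyps).
Local Notation omF_small := (sweep_omF_small hyps).
Local Notation omF2_small := (sweep_omF2_small hyps).

Lemma B_ge0 : 0 <= B.
Proof.
have F0 := F_ge0; have o0 := om_ge0; have F2 := sqr_ge0 F.
by rewrite BE; have a := mulr_ge0 o0 F2; lra.
Qed.

Lemma gp_ge4 : 4 <= gp.
Proof. by have := gp_ge; lra. Qed.

Lemma E_abs x y : `|dot x (E *m y)| <= 3 * (nrm x * nrm y).
Proof.
apply: psd_abs_le => [|t]; first exact: E_sym.
 case/andP: (E_bd t) => a b; rewrite b andbT.
exact: le_trans (dot_ge0 _) a.
Qed.

Lemma dot_comb_uh (P : pred 'I_k) c : dot (\sum_(l | P l) c l *: uh l)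
  (\sum_(l | P l) c l *: uh l) = l2 P c ^+ 2.
Proof.
rewrite sqr_l2 dot_suml; apply: eq_bigr => l li.
rewrite dot_sumr (bigD1 l) //= big1 ?addr0 => [|m /andP[_ ml]].
  by rewrite !dotZ uh_on eqxx mulr1 expr2.
by rewrite !dotZ uh_on eq_sym (negPf ml) !mulr0.
Qed.

Lemma comb_z_le_gen (P : pred 'I_k) c : l2 P (fun l => nrm (z l)) <= B ->
  nrm (\sum_(l | P l) c l *: z l) <= l2 P c * B.
Proof.
by move=> ?; apply: le_trans (nrm_comb_le _ _ _) _; rewrite ler_wpM2l ?l2_ge0.
Qed.

(** The [uh l] are orthonormal and the [z l] perturb them by at most [B] in Frobenius norm, so the
    smallest singular value of the family [hvec l] is at least 1 - B. *)
Lemma comb_lower_gen (P : pred 'I_k) c : l2 P (fun l => nrm (z l)) <= B ->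
  (1 - B) * l2 P c <= nrm (\sum_(l | P l) c l *: hvec l).
Proof.
move=> zB; have -> : \sum_(l | P l) c l *: hvec l =
  \sum_(l | P l) c l *: uh l + \sum_(l | P l) c l *: z l.
  by rewrite -big_split; apply: eq_bigr => l _; rewrite scalerDr.
set u := \sum_(l | _) _ *: uh l; set v := \sum_(l | _) _.
have e : nrm u = l2 P c.
  by rewrite nrmE dot_comb_uh sqrtr_sqr ger0_norm ?l2_ge0.
have := ler_nrmB (u + v) v; rewrite addrK e => a.
by have a' := comb_z_le_gen c zB; rewrite -/v in a'; lra.
Qed.

(** * One vector of the sweep, given bounds for the preceding ones *)

Section Step.
Variable i : 'I_k.
Hypothesis IHz : l2 (below i) (fun l => nrm (z l)) <= B.
Hypothesis IHJ : l2 (below i) (fun l => nrm (J *m hvec l)) <= F.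

Local Tactic Notation "lraw" hyp_list(l) := clear - hyps IHz IHJ l; lra.

Lemma perp_sub (l : 'I_k) y : (l <= i)%N -> perp i y -> perp l y.
Proof. by move=> li p m ml; apply: p; exact: leq_trans ml li. Qed.

Lemma perp_comb c y : perp i y ->
  dot y (\sum_(l | below i l) c l *: hvec l) = 0.
Proof.
move=> p; rewrite dot_sumr big1 // => l li.
by rewrite dotZr dotC p ?mulr0.
Qed.

Lemma perpB x y : perp i x -> perp i y -> perp i (x - y).
Proof. by move=> px py l li; rewrite dotBr px // py // subr0. Qed.

Lemma perpD x y : perp i x -> perp i y -> perp i (x + y).
Proof. by move=> px py l li; rewrite dotDr px // py // addr0. Qed.

(* The new vectors are almost [A]-invariant even when the first [k] eigenvalues
   are not separated. *)
Lemma coupling (l : 'I_k) y : (l < i)%N -> perp i y ->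
  dot (hvec l) (A *m y) = dot (z l) (E *m y).
Proof.
move=> li py; have := z_eq (perp_sub (ltnW li) py).
rewrite (dotC y (hvec l)) py // mulr0 sub0r (dot_symMC y _ A_sym).
by rewrite (dot_symMC y _ E_sym) addrC => /eqP; rewrite subr_eq0 => /eqP.
Qed.

Lemma coupling_comb c y : perp i y ->
  dot (\sum_(l | below i l) c l *: hvec l) (A *m y)
  = dot (\sum_(l | below i l) c l *: z l) (E *m y).
Proof.
move=> py; rewrite !dot_suml; apply: eq_bigr => l li.
by rewrite !dotZl coupling.
Qed.

Lemma comb_z_le c :
  nrm (\sum_(l | below i l) c l *: z l) <= l2 (below i) c * B.
Proof. exact: comb_z_le_gen. Qed.

Lemma comb_lower c :
  (1 - B) * l2 (below i) c <= nrm (\sum_(l | below i l) c l *: hvec l).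
Proof. exact: comb_lower_gen. Qed.

Lemma comb_J_le c :
  nrm (\sum_(l | below i l) c l *: (J *m hvec l)) <= l2 (below i) c * F.
Proof.
by apply: le_trans (nrm_comb_le _ _ _) _; rewrite ler_wpM2l ?l2_ge0.
Qed.

Local Notation form x := (dot x (A *m x) - lh i * dot x x).

(* Improves an upper bound [theta] of the deflated quadratic form; its infimum is
   therefore small. *)
Lemma form_step theta : 0 <= theta ->
  (forall y, perp i y -> form y <= theta * dot y y) ->
  forall y, perp i y ->
  2 * form y <= (om * F ^+ 2 + theta * (1 + B ^+ 2) ^+ 2 + L * B ^+ 4
                 + 6 * B ^+ 2 + 7 * B ^+ 3) * dot y y.
Proof.
move=> t0 valid y py.
pose zeta l := dot (z l) y.
have uy (l : 'I_k) : (l < i)%N -> dot (uh l) y = - zeta l.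
  by move=> li; have := py _ li; rewrite /hvec dotDl => /eqP; rewrite addr_eq0 => /eqP.
(* [y] is orthogonal to the earlier [hvec l], whereas the Ritz bound needs orthogonality to the
   earlier [uh l]; adding [u] repairs this. The same combination [kk] of the [z l] makes [u + kk] a
   combination of the [hvec l], to which the coupling applies. *)
pose u := \sum_(l | below i l) zeta l *: uh l.
pose kk := \sum_(l | below i l) zeta l *: z l.
pose S2 := l2 (below i) zeta ^+ 2.
have ukh : u + kk = \sum_(l | below i l) zeta l *: hvec l.
  by rewrite -big_split; apply: eq_bigr => l _; rewrite scalerDr.
have yu : dot y u = - S2.
  rewrite dot_sumr /S2 sqr_l2 -sumrN; apply: eq_bigr => l li.
  by rewrite dotZr dotC uy // mulrN expr2.
have yk : dot y kk = S2.
  rewrite dot_sumr /S2 sqr_l2; apply: eq_bigr => l li.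
  by rewrite dotZr dotC -/(zeta l) expr2.
have uu : dot u u = S2 by exact: dot_comb_uh.
have yAu : dot y (A *m u) = dot kk (E *m y) - dot y (A *m kk).
  have := coupling_comb zeta py; rewrite -ukh -/kk => <-.
  by rewrite (dot_symMC y u A_sym) (dot_symMC y kk A_sym) dotDl addrK.
have Auh l m : dot (uh m) (A *m uh l) = lh l * (m == l)%:R.
  have := r_perp m l; rewrite /resid dotBr dotZr uh_on => /eqP.
  by rewrite subr_eq0 => /eqP.
have uAu : lh i * S2 <= dot u (A *m u).
  rewrite /S2 sqr_l2 mulr_sumr /u mulmx_sumr dot_sumr; apply: ler_sum => l li.
  rewrite -scalemxAr dotZr dot_suml (bigD1 l) //= big1 => [|m /andP[_ ml]].
    rewrite dotZl Auh eqxx mulr1 addr0 mulrA -expr2 [leRHS]mulrC.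
    by apply: ler_wpM2r; rewrite ?sqr_ge0 // lh_dec // ltnW.
  by rewrite dotZl Auh (negPf ml) !mulr0.
have y'perp (l : 'I_k) : (l < i)%N -> dot (uh l) (y + u) = 0.
  move=> li; rewrite dotDr uy // /u dot_sumr (bigD1 l) //= big1.
    by rewrite dotZr uh_on eqxx mulr1 addr0 addNr.
  by move=> m /andP[_ ml]; rewrite dotZr uh_on eq_sym (negPf ml) mulr0.
have := uh_rayleigh y'perp.
rewrite mulmxDr !dotlin (dotC u y) (dot_symMC u y A_sym) yu uu yAu => H1.
(* The remaining cross term [dot y (A *m kk)] has no direct bound free of |A|. Its part [e] in the
   span of the [hvec l] is handled by the coupling, its deflated part [k'] by polarisation. *)
have [c pc] := h_proj i kk.
pose e := \sum_(l | below i l) c l *: hvec l.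
have [k' [pk' kE]] : exists k', perp i k' /\ kk = k' + e.
  by exists (kk - e); rewrite subrK.
have ke : dot k' e = 0 by exact: perp_comb.
have ye : dot y e = 0 by exact: perp_comb.
have yAe : dot y (A *m e) = dot (\sum_(l | below i l) c l *: z l) (E *m y).
  by rewrite (dot_symMC y e A_sym) coupling_comb.
have zle : l2 (below i) zeta <= B * nrm y.
  apply: le_trans (_ : l2 (below i) (fun l => nrm y * nrm (z l)) <= _).
    apply: l2_le (l2_ge0 _ _) _; rewrite sqr_l2; apply: ler_sum => l _.
    by rewrite exprMn !sqr_nrm mulrC dot_sqr_le.
  by rewrite l2Z ?nrm_ge0 // mulrC ler_wpM2r ?nrm_ge0.
have kle : nrm kk <= B ^+ 2 * nrm y.
  apply: le_trans (comb_z_le _) _; rewrite expr2 -mulrA mulrC.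
  by rewrite ler_wpM2l ?B_ge0.
have kk2 : dot kk kk = dot k' k' + dot e e.
  by rewrite kE !dotlin (dotC e k') ke; ring.
have k'le : dot k' k' <= B ^+ 4 * dot y y.
  rewrite -[B ^+ 4]/(B ^+ (2 * 2)) exprM -(sqr_nrm y) -exprMn.
  apply: le_trans (_ : nrm kk ^+ 2 <= _).
    by rewrite sqr_nrm kk2 lerDl dot_ge0.
  by rewrite ler_sqr ?nnegrE ?nrm_ge0 // mulr_ge0 ?nrm_ge0 ?sqr_ge0.
have ele : nrm e <= B ^+ 2 * nrm y.
  apply: le_trans kle; apply: nrm_le (nrm_ge0 _) _.
  by rewrite sqr_nrm kk2 lerDr dot_ge0.
have cle : (1 - B) * l2 (below i) c <= B ^+ 2 * nrm y.
  exact: le_trans (comb_lower _) ele.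
have N0 := nrm_ge0 y.
have yy : nrm y * nrm y = dot y y by rewrite -expr2 sqr_nrm.
have c7 : 6 * l2 (below i) c <= 7 * (B ^+ 2 * nrm y).
  have c0 := l2_ge0 (below i) c.
  have c1 := ler_wpM2r c0 B_small; lraw c0 c1 cle.
have yAe_le : 2 * dot y (A *m e) <= 7 * B ^+ 3 * dot y y.
  rewrite yAe; have /(le_trans (ler_norm _)) b1 :=
    E_abs (\sum_(l | below i l) c l *: z l) y.
  have b2 := ler_wpM2r N0 (comb_z_le c).
  have b3 := ler_wpM2r (mulr_ge0 B_ge0 N0) c7.
  have -> : 7 * B ^+ 3 * dot y y = 7 * (B ^+ 2 * nrm y) * (B * nrm y).
    by rewrite -yy; ring.
  lraw b1 b2 b3.
have kEy_ge : - (3 * B ^+ 2 * dot y y) <= dot kk (E *m y).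
  have := E_abs kk y; rewrite ler_norml => /andP[b1 _].
  have b2 := ler_wpM2r N0 kle; rewrite -yy; lraw b1 b2.
have yk'le : dot (y + k') (y + k') <= (1 + B ^+ 2) ^+ 2 * dot y y.
  rewrite -!sqr_nrm -exprMn ler_sqr ?nnegrE ?nrm_ge0 ?mulr_ge0 ?nrm_ge0 //;
    last by rewrite addr_ge0 // sqr_ge0.
  apply: le_trans (ler_nrmD _ _) _; rewrite mulrDl mul1r lerD2l.
  apply: nrm_le; first by rewrite mulr_ge0 ?nrm_ge0 ?sqr_ge0.
  by rewrite exprMn sqr_nrm -exprM.
(* Polarisation: the assumed bound at y + k' controls 2 [dot y (A *m k')] up to - form y, which
   accounts for the factor 2 in the conclusion. The terms 2 lh_i [S2] cancel because [dot y k'] =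
   [S2]. *)
have := valid _ (perpD py pk').
rewrite mulmxDr !dotDl !dotDr (dotC k' y) (dot_symMC k' y A_sym) => H2.
have tle := ler_wpM2l t0 yk'le; rewrite !dotDl !dotDr (dotC k' y) in tle.
have /andP[Ak' _] := A_bd k'.
have lk' : lh i * dot k' k' <= L * B ^+ 4 * dot y y.
  case/andP: (lh_bd i) => l0 l1; have b1 := ler_wpM2r (dot_ge0 k') l1.
  have b2 := ler_wpM2l L_ge0 k'le; lraw b1 b2.
have S20 : 0 <= S2 by rewrite sqr_ge0.
have wF0 : 0 <= om * F ^+ 2 * S2.
  by rewrite mulr_ge0 // mulr_ge0 ?om_ge0 // sqr_ge0.
have yAkk : dot y (A *m kk) = dot y (A *m k') + dot y (A *m e).
  by rewrite {1}kE mulmxDr dotDr.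
have ykk : S2 = dot y k' by rewrite -yk kE dotDr ye addr0.
rewrite ykk in H1 uAu wF0.
rewrite yAkk in H1.
lraw H1 H2 tle Ak' lk' wF0 uAu kEy_ge yAe_le.
Qed.

(** The value [L] is admissible, and [form_step] replaces an admissible [t] by (t (1 + B^2)^2 + C) /
    2. The infimum is admissible too, hence not larger than its own image, which forces it to be of
    the order of [C]. *)
Lemma rayleigh_bound y : perp i y ->
  dot y (A *m y) <= (lh i + 1 / 2 / 10 ^+ 3) * dot y y.
Proof.
pose T : set R := [set t | 0 <= t /\ forall y, perp i y -> form y <= t * dot y y]%classic.
have TL : T L.
  split=> [|x px]; first exact: L_ge0.
  case/andP: (A_bd x) => _ b.
  have /andP[l0 _] := lh_bd i; have b' := mulr_ge0 l0 (dot_ge0 x); lraw b b'.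
have T0 : (T !=set0)%classic by exists L.
have Tlb : lbound T 0 by move=> t [].
have hinf : has_inf T by split=> //; exists 0.
set t := inf T.
have t0 : 0 <= t by exact: lb_le_inf.
have Tt x : perp i x -> form x <= t * dot x x.
  move=> px; have [x0|x0] := eqVneq x 0.
    by rewrite x0 mulmx0 !dot0l !mulr0 subrr.
  have xx : 0 < dot x x.
    by rewrite lt_def dot_ge0 andbT; apply: contra_neq x0; exact: dot_eq0.
  rewrite -ler_pdivrMr //; apply: lb_le_inf => // s [_ /(_ _ px)].
  by rewrite ler_pdivrMr.
set C := om * F ^+ 2 + L * B ^+ 4 + 6 * B ^+ 2 + 7 * B ^+ 3.
have C0 : 0 <= C.
  have F0 := F_ge0; have o0 := om_ge0; have L0 := L_ge0; have b0 := B_ge0.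
  rewrite /C !addr_ge0 //; apply: mulr_ge0 => //; exact: exprn_ge0.
have Ts : T ((t * (1 + B ^+ 2) ^+ 2 + C) / 2).
  split.
    by rewrite divr_ge0 // addr_ge0 // mulr_ge0 // sqr_ge0.
  move=> x px; have a := form_step t0 Tt px; rewrite /C; lraw a.
have tle : t <= (t * (1 + B ^+ 2) ^+ 2 + C) / 2.
  by apply: ge_inf => //; exists 0.
have B1 : B <= 1 / 10 ^+ 3 by apply: le_trans B_small _; lraw.
have B2 : B ^+ 2 <= 1 / 10 ^+ 3 * (1 / 10 ^+ 3).
  by rewrite expr2; exact: (ler_pM B_ge0 B_ge0 B1 B1).
have B20 : 0 <= B ^+ 2 by exact: sqr_ge0.
have B3 : B ^+ 3 <= 1 / 10 ^+ 3 * (1 / 10 ^+ 3).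
  rewrite exprS; have a := ler_wpM2r B20 B1; lraw a B2.
have B4 : (1 + B ^+ 2) ^+ 2 <= 101 / 100.
  have a := ler_wpM2r B20 B2; lraw a B20 B2.
have C1 : C <= 1 / 5 / 10 ^+ 3.
  move: omF2_small LB4_small B2 B3; rewrite /C.
  move: (om * F ^+ 2) (L * B ^+ 4) (B ^+ 2) (B ^+ 3) => b1 b2 b3 b4 *. lra.
have t1 : t <= 1 / 2 / 10 ^+ 3.
  have a := ler_wpM2l t0 B4; lraw a C1 t0 tle.
move=> py; have a := Tt _ py.
have b := ler_wpM2r (dot_ge0 y) t1; lraw a b.
Qed.

Lemma Jdot x y : dot (J *m x) (J *m y) = dot (J *m x) y.
Proof. by rewrite [RHS]dotC -[in RHS]J_idem -mulmxA dot_symM ?J_sym // dotC. Qed.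

Lemma nrmJ x : nrm (J *m x) <= nrm x.
Proof.
have [->|x0] := eqVneq (nrm (J *m x)) 0; first exact: nrm_ge0.
have p : 0 < nrm (J *m x) by rewrite lt_def x0 nrm_ge0.
by rewrite -(ler_pM2l p) -expr2 sqr_nrm Jdot dot_le.
Qed.

Lemma dotJAJ x y : dot (J *m x) (A *m (J *m y)) = dot (J *m x) (A *m y).
Proof.
rewrite -!(dot_symM _ _ J_sym); congr dot.
by rewrite !mulmxA -AJ -(mulmxA A J J) J_idem.
Qed.

(** Removing from [t] its component [e] along the earlier [hvec l] costs only O(F): as J t = t, the
    product of [e] and [t] sees only the vectors J [hvec l], whose l2 sum is at most [F]. *)
Lemma J_decomp t : J *m t = t -> exists y d,
  let e := \sum_(l | below i l) d l *: hvec l in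
  [/\ t = y + e, perp i y, nrm y <= nrm t, nrm e <= 101 / 100 * F * nrm t
    & l2 (below i) d <= 101 / 100 * F * nrm t].
Proof.
move=> Jt; have [d pd] := h_proj i t.
set e := \sum_(l | _) _ in pd.
exists (t - e), d => /=; rewrite -/e.
have ye : dot (t - e) e = 0 by exact: perp_comb.
have d0 := l2_ge0 (below i) d; have e0 := nrm_ge0 e; have t0 := nrm_ge0 t.
have ee : nrm e ^+ 2 <= l2 (below i) d * F * nrm t.
  rewrite sqr_nrm; have -> : dot e e = dot e t.
    by apply/eqP; rewrite -subr_eq0 -opprB oppr_eq0 -dotBr dotC ye.
  have -> : dot e t = dot (\sum_(l | below i l) d l *: (J *m hvec l)) t.
    rewrite !dot_suml; apply: eq_bigr => l _.
    by rewrite !dotZl -dot_symM ?J_sym // Jt.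
  apply: le_trans (dot_le _ _) _; apply: ler_wpM2r => //.
  exact: comb_J_le.
have low : (1 - B) * l2 (below i) d <= nrm e by exact: comb_lower.
have B1 : 1 - 1 / 10 ^+ 4 <= 1 - B by rewrite lerD2l lerN2 B_small.
have low' := le_trans (ler_wpM2r d0 B1) low.
have Ft0 : 0 <= F * nrm t by rewrite mulr_ge0 ?F_ge0.
have ele : nrm e <= 201 / 200 * (F * nrm t).
  have [->|en] := eqVneq (nrm e) 0; first by lraw Ft0.
  have ep : 0 < nrm e by rewrite lt_def en.
  rewrite -(ler_pM2l ep) -expr2; apply: le_trans ee _.
  have a1 := ler_wpM2r Ft0 low'; have a2 := mulr_ge0 d0 Ft0.
  have a3 := mulr_ge0 e0 Ft0; lraw a1 a2 a3.
split; rewrite ?subrK //; last 2 first.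
- lraw ele Ft0.
- lraw ele low' d0 Ft0.
apply: nrm_le (nrm_ge0 _) _; rewrite sqr_nrm.
have -> : dot t t = dot (t - e) (t - e) + dot e e.
  rewrite -{1 2}(subrK e t) [LHS]dotDl !(dotDr _ (t - e)) (dotC e (t - e)) ye.
  by rewrite addr0 add0r.
by rewrite lerDl dot_ge0.
Qed.

Local Notation X := (nrm (E *m z i)).
Local Notation tau := (l2 (below i) (fun l => dot (uh i) (z l))).
Local Notation tau' := (l2 (below i) (fun l => dot (z l) (E *m uh i))).
Local Notation b := (nrm (J *m uh i)).

Lemma nrm_z_le : nrm (z i) <= X.
Proof.
have [->|zn] := eqVneq (nrm (z i)) 0; first exact: nrm_ge0.
have zp : 0 < nrm (z i) by rewrite lt_def zn nrm_ge0.
rewrite -(ler_pM2l zp) -expr2 sqr_nrm; case/andP: (E_bd (z i)) => a _.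
exact: le_trans a (dot_le _ _).
Qed.

(** This is E^2 <= 3 E, obtained from Cauchy-Schwarz for the form [E] between z_i and E z_i. *)
Lemma sqr_X_le : X ^+ 2 <= 3 * dot (z i) (E *m z i).
Proof.
have e : dot (z i) (E *m (E *m z i)) = X ^+ 2.
  by rewrite dot_symM ?E_sym // -sqr_nrm.
have Epsd t : 0 <= dot t (E *m t).
  by case/andP: (E_bd t) => a _; exact: le_trans (dot_ge0 _) a.
have := psd_cauchy_schwarz (z i) (E *m z i) E_sym Epsd.
rewrite e => cs; have /andP[_ b2] := E_bd (E *m z i).
rewrite -sqr_nrm in b2.
have := le_trans cs (ler_wpM2l (Epsd (z i)) b2).
have [->|X0] := eqVneq X 0; first by rewrite expr0n /= mulr_ge0.
have X2 : 0 < X ^+ 2 by rewrite exprn_gt0 // lt_def X0 nrm_ge0.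
have -> : dot (z i) (E *m z i) * (3 * X ^+ 2)
  = 3 * dot (z i) (E *m z i) * X ^+ 2 by ring.
by rewrite expr2 ler_pM2r.
Qed.

(* The equation of [w], the deflated [hvec i], is tested with [J w], which
   controls [J w] by [E z / gp], and with [(1 - J) z], on which [lh i - A] is
   almost nonnegative. *)
Lemma step_bound :
  X <= 7 / 2 * b + 60 * (om * F * b) + (tau + tau') / 20 /\
  nrm (J *m hvec i) <=
    (X + (X + tau' + 2 * tau) / 5 / 10 ^+ 3) / gp + 101 / 100 * F * tau.
Proof.
pose Xi := (X + tau' + 2 * tau) / 5 / 10 ^+ 3; rewrite -/Xi.
have [c pc] := h_proj i (uh i).
set q := \sum_(l | _) _ in pc.
pose cz := \sum_(l | below i l) c l *: z l.
(* Since z_i is already deflated, subtracting the projection [q] of [uh i] deflates [hvec i]. *)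
pose w := hvec i - q.
have pw : perp i w.
  by rewrite /w /hvec addrAC; apply: perpD => //; exact: z_perp.
have X0 : 0 <= X := nrm_ge0 _.
have t0 : 0 <= tau := l2_ge0 _ _.
have t'0 : 0 <= tau' := l2_ge0 _ _.
have b0 : 0 <= b := nrm_ge0 _.
have c0 := l2_ge0 (below i) c; have q0 := nrm_ge0 q.
have zX := nrm_z_le; have z0 := nrm_ge0 (z i).
have low : (1 - B) * l2 (below i) c <= nrm q by exact: comb_lower.
have B1 : 1 - 1 / 10 ^+ 4 <= 1 - B by rewrite lerD2l lerN2 B_small.
have low' := le_trans (ler_wpM2r c0 B1) low.
(* The earlier [uh l] are orthogonal to [uh i], so the product of [q] with [uh i] sees only the
   [z l]; thus |q| is of the order of [tau]. *)
have qq : nrm q ^+ 2 <= l2 (below i) c * tau.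
  rewrite sqr_nrm; have -> : dot q q = dot q (uh i).
    apply/eqP; rewrite -subr_eq0 -opprB oppr_eq0 -dotBr dotC.
    by rewrite perp_comb.
  have -> : dot q (uh i) = \sum_(l | below i l) c l * dot (uh i) (z l).
    rewrite /q dot_suml; apply: eq_bigr => l li.
    rewrite dotZl /hvec dotDl uh_on (dotC (z l)).
    by rewrite (_ : l == i = false) ?add0r //; apply/eqP => e; move: li; rewrite /below e ltnn.
  exact: le_trans (ler_norm _) (l2_sum_le _ _ _).
have qle : nrm q <= 201 / 200 * tau.
  have [->|qn] := eqVneq (nrm q) 0; first by lraw t0.
  have qp : 0 < nrm q by rewrite lt_def qn.
  rewrite -(ler_pM2l qp) -expr2; apply: le_trans qq _.
  have a1 := ler_wpM2r t0 low'; have a2 := mulr_ge0 c0 t0.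
  have a3 := mulr_ge0 q0 t0; lraw a1 a2 a3.
have cle : l2 (below i) c <= 101 / 100 * tau by lraw low' qle c0 t0.
have czle : nrm cz <= 101 / 100 * B * tau.
  apply: le_trans (comb_z_le c) _; have a := ler_wpM2r B_ge0 cle; lraw a.
have Jqle : nrm (J *m q) <= 101 / 100 * F * tau.
  rewrite /q mulmx_sumr; under eq_bigr do rewrite -scalemxAr.
  apply: le_trans (comb_J_le c) _; have a := ler_wpM2r F_ge0 cle; lraw a.
(* The equation of the i-th vector holds against the deflated part [y] only. On the small part [e]
   of the test vector, and on [q], the coupling replaces [A] by [E], so that no factor of size |A|
   appears. *)
have test x y d T : x = y + \sum_(l | below i l) d l *: hvec l -> perp i y ->
    nrm y <= T -> nrm (\sum_(l | below i l) d l *: hvec l) <= 101 / 100 * F * T ->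
    l2 (below i) d <= 101 / 100 * F * T ->
    `|lh i * dot x w - dot x (A *m w) + dot x (E *m z i)| <= T * Xi.
  move=> xE py yT; set e := \sum_(l | _) _ in xE * => eT dT.
  have T0 : 0 <= T := le_trans (nrm_ge0 _) yT.
  have d0 := l2_ge0 (below i) d.
  pose dz := \sum_(l | below i l) d l *: z l.
  have -> : lh i * dot x w - dot x (A *m w) + dot x (E *m z i)
    = dot e (E *m z i) + dot cz (E *m y) - dot dz (E *m w).
    have eAw : dot e (A *m w) = dot dz (E *m w) by exact: coupling_comb.
    have ew : dot e w = 0 by rewrite dotC; exact: perp_comb.
    have qAy : dot q (A *m y) = dot cz (E *m y) by exact: coupling_comb.
    have yq : dot y q = 0 by exact: perp_comb.
    have := z_eq py; have hE : hvec i = w + q by rewrite subrK.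
    rewrite hE mulmxDr (dotDr y w) (dotDr y (A *m w)) yq (dot_symMC y q A_sym) qAy => zq.
    rewrite xE !dotDl eAw ew; lraw zq.
  have dzw : dot dz (E *m w) = \sum_(l | below i l) d l * dot (z l) (E *m uh i)
     + dot dz (E *m (z i - q)).
    rewrite /w /hvec -addrA mulmxDr dotDr; congr (_ + _).
    by rewrite /dz dot_suml; apply: eq_bigr => l _; rewrite dotZl.
  have i1 := abs_dot_le e (E *m z i); 
  have i2 := E_abs cz y.
  have i3 := l2_sum_le (below i) d (fun l => dot (z l) (E *m uh i)).
  have i4 := E_abs dz (z i - q).
  have i5 := ler_nrmB (z i) q.
  have i6 := comb_z_le d; rewrite -/dz in i6.
  have Ts0 : 0 <= 101 / 100 * F * T.
    have a := mulr_ge0 F_ge0 T0; lraw a.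
  have j1 : nrm e * X <= 101 / 100 / 10 ^+ 4 * (T * X).
    apply: le_trans (ler_wpM2r X0 eT) _.
    have a := ler_wpM2r (mulr_ge0 T0 X0) F_small; lraw a.
  have Bt0 : 0 <= 101 / 100 * B * tau.
    have a := mulr_ge0 B_ge0 t0; lraw a.
  have j2 : nrm cz * nrm y <= 101 / 100 / 10 ^+ 4 * (T * tau).
    have a1 := ler_pM (nrm_ge0 cz) (nrm_ge0 y) czle yT.
    have a2 := ler_wpM2r (mulr_ge0 T0 t0) B_small; lraw a1 a2.
  have j3 : l2 (below i) d * tau' <= 101 / 100 / 10 ^+ 4 * (T * tau').
    apply: le_trans (ler_wpM2r t'0 dT) _.
    have a := ler_wpM2r (mulr_ge0 T0 t'0) F_small; lraw a.
  have j4 : nrm dz * nrm (z i - q) <= 1 / 32 / 10 ^+ 3 * (T * X + 201 / 200 * (T * tau)).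
    have i5' : nrm (z i - q) <= X + 201 / 200 * tau by lraw i5 zX qle.
    have i6' : nrm dz <= T * (1 / 32 / 10 ^+ 3).
      apply: le_trans i6 _; apply: le_trans (ler_wpM2r B_ge0 dT) _.
      have k1 := ler_wpM2r T0 F_small.
      have k2 := ler_wpM2l (mulr_ge0 F_ge0 T0) B_small; lraw k1 k2 T0.
    have a := ler_pM (nrm_ge0 _) (nrm_ge0 _) i6' i5'; lraw a.
  have TX0 := mulr_ge0 T0 X0; have Tt0 := mulr_ge0 T0 t0.
  have Tt'0 := mulr_ge0 T0 t'0.
  have XiE : T * Xi = 1 / 5 / 10 ^+ 3 * (T * X) + 1 / 5 / 10 ^+ 3 * (T * tau')
     + 1 / 25 / 10 ^+ 2 * (T * tau) by rewrite /Xi; field.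
  rewrite XiE dzw; apply: le_trans (ler_normB _ _) _.
  apply: le_trans (lerD (ler_normD _ _) (ler_normD _ _)) _.
  lraw i1 i2 i3 i4 j1 j2 j3 j4 TX0 Tt0 Tt'0.
have DJ x y : lh i * dot (J *m x) y - dot (J *m x) (A *m y)
    = lh i * dot (J *m x) (J *m y) - dot (J *m x) (A *m (J *m y)).
  by rewrite Jdot dotJAJ.
pose p := J *m w.
have JJ (x : 'cV[R]_n) : J *m (J *m x) = J *m x by rewrite mulmxA J_idem.
have p0 := nrm_ge0 p.
have pD : gp * nrm p ^+ 2 <= nrm p * Xi - dot p (E *m z i).
  have [y [d [tE py yT eT dT]]] := J_decomp (JJ w).
  have := test _ _ _ _ tE py yT eT dT; rewrite -/p DJ -/p.
  rewrite ler_norml => /andP[_ t1].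
  have /andP[t2 _] := J_bd i (JJ w).
  rewrite -/p in t2; rewrite sqr_nrm; lraw t1 t2.
have pEz := dot_ge p (E *m z i).
have p1 : nrm p * gp <= X + Xi.
  have [->|pn] := eqVneq (nrm p) 0.
    by rewrite mul0r /Xi; lraw X0 t0 t'0.
  have pp : 0 < nrm p by rewrite lt_def pn.
  rewrite -(ler_pM2l pp); lraw pD pEz.
have JhE : J *m hvec i = p + J *m q by rewrite -mulmxDr subrK.
split; last first.
  rewrite JhE; apply: le_trans (ler_nrmD _ _) _; apply: lerD => //.
  by rewrite ler_pdivlMr //; exact: lt_le_trans gp_ge4.
have [x xdef] : exists x, x = z i - J *m z i by eexists.
have zE : z i = x + J *m z i by rewrite xdef subrK.
have JzE : J *m z i = p + J *m q - J *m uh i.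
  by rewrite -JhE /hvec mulmxDr [X in X - _]addrC addrK.
have jzle : nrm (J *m z i) <= nrm p + 101 / 100 * F * tau + b.
  rewrite JzE; apply: le_trans (ler_nrmB _ _) _; rewrite lerD2r.
  by apply: le_trans (ler_nrmD _ _) _; rewrite lerD2l.
have Jz0 := nrm_ge0 (J *m z i).
have [y2 [d2 [tE py2 y2T eT dT]]] := J_decomp (JJ (z i)).
set e2 := \sum_(l | _) _ in tE eT.
have xE : x = (z i - y2) + \sum_(l | below i l) (- d2 l) *: hvec l.
  rewrite xdef {1}tE opprD addrA; congr (_ + _).
  by rewrite -sumrN; apply: eq_bigr => l _; rewrite scaleNr.
have py : perp i (z i - y2) by apply: perpB => //; exact: z_perp.
have [y ydef] : exists y, y = z i - y2 by eexists.
rewrite -ydef in xE py.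
set e := \sum_(l | _) _ in xE.
have eN : e = - e2 by rewrite /e /e2 -sumrN; apply: eq_bigr => l _; rewrite scaleNr.
have Jx0 : J *m x = 0 by rewrite xdef mulmxBr JJ subrr.
have xJ t : dot x (J *m t) = 0 by rewrite dot_symM ?J_sym // Jx0 dot0l.
have xx : dot x x <= dot (z i) (z i).
  rewrite zE !dotDl !dotDr (dotC _ x) xJ addr0 add0r lerDl; exact: dot_ge0.
have xy : dot x x = dot y y + dot e e.
  have ye : dot y e = 0 by exact: perp_comb.
  by rewrite xE !dotDl !dotDr (dotC e y) ye addr0 add0r.
have yz : nrm y <= nrm (z i).
  apply: nrm_le => //; rewrite sqr_nrm; have a := dot_ge0 e; lraw a xx xy.
have Fz : 101 / 100 * F * nrm (J *m z i) <= 101 / 100 * F * nrm (z i).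
  have a := ler_wpM2l F_ge0 (nrmJ (z i)); lraw a.
have ez : nrm e <= 101 / 100 * F * nrm (z i).
  by rewrite eN nrmN; exact: le_trans eT Fz.
have dN : l2 (below i) (fun l => - d2 l) = l2 (below i) d2.
  by congr Num.sqrt; apply: eq_bigr => l _; rewrite sqrrN.
have dz : l2 (below i) (fun l => - d2 l) <= 101 / 100 * F * nrm (z i).
  by rewrite dN; exact: le_trans dT Fz.
have := test _ _ _ _ xE py yz ez dz.
rewrite ler_norml => /andP[_ tx].
(* [rayleigh_bound] covers the deflated part [y] of [x]. The rest [e] has length O(F |z_i|), hence
   energy O(L F^2 |z_i|^2), and the cross term goes through the coupling. *)
have formx : dot x (A *m x) - lh i * dot x x <= nrm (z i) ^+ 2 / 10 ^+ 3.
  have ry := rayleigh_bound py.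
  have ye : dot y e = 0 by exact: perp_comb.
  have eAy : dot e (A *m y) = dot (\sum_(l | below i l) (- d2 l) *: z l) (E *m y).
    exact: coupling_comb.
  have c1 := comb_z_le (fun l => - d2 l).
  have := E_abs (\sum_(l | below i l) (- d2 l) *: z l) y.
  rewrite -eAy ler_norml => /andP[_ c2].
  have zz0 : 0 <= nrm (z i) * nrm (z i) by rewrite mulr_ge0.
  have c3 : nrm (\sum_(l | below i l) (- d2 l) *: z l) <= 1 / 32 / 10 ^+ 3 * nrm (z i).
    apply: le_trans c1 _; apply: le_trans (ler_wpM2r B_ge0 dz) _.
    have k1 := ler_wpM2r z0 F_small.
    have k2 := ler_wpM2l (mulr_ge0 F_ge0 z0) B_small; lraw k1 k2 z0.
  have c4 := ler_pM (nrm_ge0 _) (nrm_ge0 _) c3 yz.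
  have e_le : L * dot e e <= 2 / 10 ^+ 4 * (nrm (z i) * nrm (z i)).
    have : dot e e <= (101 / 100 * F * nrm (z i)) ^+ 2.
      by rewrite -sqr_nrm ler_sqr ?nnegrE ?nrm_ge0 //; have a := mulr_ge0 F_ge0 z0; lraw a.
    move=> /(ler_wpM2l L_ge0) k1; apply: le_trans k1 _.
    have k2 := ler_wpM2r zz0 LF2_small; rewrite !exprMn (expr2 (nrm _)).
    lraw k2 zz0.
  have /andP[_ Ae] := A_bd e; have /andP[l0 _] := lh_bd i.
  have le0 := mulr_ge0 l0 (dot_ge0 e).
  have yy : dot y y <= nrm (z i) * nrm (z i).
    by rewrite -sqr_nrm expr2 ler_pM ?nrm_ge0.
  rewrite {1}xE xy xE mulmxDr !dotDl !dotDr (dot_symMC y e A_sym) expr2.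
  lraw ry c2 c4 e_le Ae l0 le0 yy zz0.
(* Here w = uh_i + z_i - q. The Ritz vector contributes its residual; z_i contributes the form at
   [x], because [A] commutes with [J] and J x = 0; for [q], writing x = z_i - J z_i gives a coupling
   term and a term inside the range of [J]. *)
have xw : lh i * dot x w - dot x (A *m w) = - dot (z i) (resid i - J *m resid i)
   - (dot x (A *m x) - lh i * dot x x) + dot cz (E *m z i)
   + (lh i * dot (J *m z i) (J *m q) - dot (J *m z i) (A *m (J *m q))).
  rewrite -DJ.
  have qAz : dot q (A *m z i) = dot cz (E *m z i).
    by apply: coupling_comb; exact: z_perp.
  have zq : dot (z i) q = 0 by apply: perp_comb; exact: z_perp.
  have zr : dot (z i) (resid i - J *m resid i) = dot x (resid i).
    by rewrite xdef dotBl dotBr -dot_symM ?J_sym.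
  have xz : dot x (z i) = dot x x.
    by rewrite {1}zE dotDr xJ addr0.
  have xAz : dot x (A *m z i) = dot x (A *m x).
    rewrite {1}zE mulmxDr dotDr -[RHS]addr0; congr (_ + _).
    by rewrite mulmxA AJ -mulmxA xJ.
  have zAq : dot x (A *m q) = dot cz (E *m z i) - dot (J *m z i) (A *m q).
    by rewrite xdef dotBl (dot_symMC (z i) q A_sym) qAz.
  have xq : dot x q = - dot (J *m z i) q by rewrite xdef dotBl zq sub0r.
  rewrite zr /w /hvec /resid mulmxBr mulmxDr !dotBr !dotDr dotZr xz xAz zAq xq.
  ring.
have Dle : `|lh i * dot (J *m z i) (J *m q) - dot (J *m z i) (A *m (J *m q))|
    <= om * (nrm (J *m z i) * nrm (J *m q)).
  (* On the range of [J] the form lh_i - A lies between 0 and [om], so Cauchy-Schwarz bounds the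
     mixed term. *)
  pose M := J *m ((lh i)%:M - A) *m J.
  have ME u v : dot (J *m u) (M *m (J *m v))
    = lh i * dot (J *m u) (J *m v) - dot (J *m u) (A *m (J *m v)).
    rewrite /M -!mulmxA JJ.
    by rewrite dot_symM ?J_sym // JJ mulmxBl mul_scalar_mx dotBr dotZr.
  rewrite -ME; apply: psd_abs_le.
    by rewrite /M !trmx_mul J_sym linearB /= tr_scalar_mx A_sym mulmxA.
  move=> t; rewrite /M -mulmxA -mulmxA dot_symM ?J_sym // mulmxBl mul_scalar_mx dotBr dotZr.
  have /andP[u1 u2] := J_bd i (JJ t).
  have u3 : om * dot (J *m t) (J *m t) <= om * dot t t.
    by rewrite ler_wpM2l ?om_ge0 // -!sqr_nrm ler_sqr ?nnegrE ?nrm_ge0 // nrmJ.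
  have u4 : 0 <= gp * dot (J *m t) (J *m t).
    by rewrite mulr_ge0 ?dot_ge0 //; exact: le_trans gp_ge4.
  by apply/andP; split; [lraw u1 u4|lraw u2 u3].
have Dle2 : om * (nrm (J *m z i) * nrm (J *m q))
    <= 101 / 100 * om * F * tau * nrm (J *m z i).
  have a := ler_wpM2l (mulr_ge0 om_ge0 Jz0) Jqle; lraw a.
rewrite ler_norml in Dle; case/andP: Dle => Dle _.
have zr := dot_le (z i) (resid i - J *m resid i).
have zr2 := ler_wpM2l z0 (r_bd i).
have czE := dot_ge cz (E *m z i).
have czX := ler_wpM2r X0 czle.
have JqE := dot_le (J *m q) (E *m z i).
have JqX := ler_wpM2r X0 Jqle.
have JuE := dot_ge (J *m uh i) (E *m z i).
have gpp : 0 <= gp * nrm p ^+ 2 by rewrite mulr_ge0 ?exprn_ge0 //; exact: le_trans gp_ge4.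
have zEzE : dot (z i) (E *m z i) = dot x (E *m z i) + dot p (E *m z i)
  + dot (J *m q) (E *m z i) - dot (J *m uh i) (E *m z i).
  by rewrite {1}zE dotDl JzE dotBl dotDl; ring.
apply: (@step_scalar _ X b tau tau' (nrm p) (nrm (z i)) (nrm (J *m z i)) om F gp B
  (dot (z i) (E *m z i)) Xi) => //; try by case: hyps.
- exact: B_ge0.
- exact: gp_ge4.
- by rewrite z0.
- exact: sqr_X_le.
rewrite zEzE; lraw tx formx xw Dle Dle2 zr zr2 czE czX JqE JqX JuE pD gpp.
Qed.

End Step.
Local Tactic Notation "lraw" hyp_list(l) := clear - hyps l; lra.

(** * Summation over the sweep *)

Lemma bessel x : \sum_i dot (uh i) x ^+ 2 <= dot x x.
Proof.
pose y := \sum_(l | predT l) dot (uh l) x *: uh l.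
have yy : dot y y = \sum_i dot (uh i) x ^+ 2.
  by rewrite dot_comb_uh sqr_l2.
have yx : dot y x = \sum_i dot (uh i) x ^+ 2.
  by rewrite dot_suml; apply: eq_bigr => i _; rewrite dotZl expr2.
have := dot_ge0 (x - y); rewrite !dotBl !dotBr (dotC x y) yy yx => a; lraw a.
Qed.

(** Exchanging the sums leaves, for each [l], a Bessel sum over i. This keeps the feedback of
    earlier vectors independent of k, and the right-hand side involves only indices below [m], as an
    induction requires. *)
Lemma l2_below_le m (v : 'I_k -> 'cV[R]_n) :
  l2 (below m.+1) (fun i => l2 (below i) (fun l => dot (uh i) (v l)))
  <= l2 (below m) (fun l => nrm (v l)).
Proof.
apply: l2_le (l2_ge0 _ _) _; rewrite sqr_l2.
apply: le_trans (_ : \sum_(i | below m.+1 i)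
   \sum_(l | below m l) dot (uh i) (v l) ^+ 2 <= _).
  apply: ler_sum => i im; rewrite -!sqr_l2 ler_sqr ?nnegrE ?l2_ge0 //.
  by apply: l2_sub => l li; apply: leq_trans li _; rewrite -ltnS.
rewrite exchange_big /=; apply: ler_sum => l _; rewrite sqr_nrm.
apply: le_trans (bessel _); rewrite [leRHS](bigID (below m.+1)) /= lerDl.
by apply: sumr_ge0 => i _; rewrite sqr_ge0.
Qed.

Lemma nrm_E_le x : nrm (E *m x) <= 3 * nrm x.
Proof.
have [->|n0] := eqVneq (nrm (E *m x)) 0; first by rewrite mulr_ge0 ?nrm_ge0.
have p : 0 < nrm (E *m x) by rewrite lt_def n0 nrm_ge0.
rewrite -(ler_pM2l p) -expr2 sqr_nrm mulrCA.
exact: le_trans (ler_norm _) (E_abs _ _).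
Qed.

(** Both bounds are carried together and do not depend on [m]: the second is at most [F], which
    restores the hypothesis of [step_bound] for the next vector. *)
Lemma sweep_l2 m :
  l2 (below m) (fun i => nrm (z i)) <= B /\
  l2 (below m) (fun i => nrm (J *m hvec i)) <=
    501 / 500 * B / gp + 101 / 100 * F * B.
Proof.
have F0 := F_ge0; have B0 := B_ge0; have o0 := om_ge0; have g4 := gp_ge4.
have gpos : 0 < gp by exact: lt_le_trans g4.
have FB0 := mulr_ge0 F0 B0.
(* As gp >= 24/5 and B is 9/2 F to leading order, the main factor is 501/500 * 9/2 * 5/24, about
   0.94. *)
have P_F : 501 / 500 * B / gp + 101 / 100 * F * B <= F.
  have e1 : F / gp <= 5 / 24 * F.
    have a : gp^-1 <= 5 / 24.
      rewrite -[leRHS]invrK lef_pV2 ?posrE //; last by rewrite invr_gt0; lraw.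
      by apply: le_trans gp_ge; lraw.
    have b := ler_wpM2l F0 a; lraw b.
  have e2 : om * F ^+ 2 / gp <= 1 / 10 ^+ 4 * F.
    rewrite ler_pdivrMr //; have a := ler_wpM2r F0 omF_small; lraw a.
  have e3 := ler_wpM2l F0 B_small.
  have -> : 501 / 500 * B / gp = 501 / 500 * (9 / 2 * (F / gp) + 75 * (om * F ^+ 2 / gp)).
    by rewrite {1}BE; ring.
  lraw e1 e2 e3 F0.
elim: m => [|m [IHz IHJ]].
  have l20 a : l2 (below 0) a = 0 by rewrite /l2 big_pred0 ?sqrtr0.
  rewrite !l20; split=> //; apply: addr_ge0.
    by apply: divr_ge0; [lraw B0|exact: ltW].
  by lraw FB0.
have IHJF := le_trans IHJ P_F.
have IHi (i : 'I_k) : below m.+1 i ->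
    l2 (below i) (fun l => nrm (z l)) <= B /\
    l2 (below i) (fun l => nrm (J *m hvec l)) <= F.
  move=> im; have sub l : below i l -> below m l.
    by move=> li; apply: leq_trans li _; rewrite -ltnS.
  by split; [apply: le_trans IHz|apply: le_trans IHJF]; exact: l2_sub.
pose P := below m.+1.
pose b i := nrm (J *m uh i).
pose X i := nrm (E *m z i).
pose t (i : 'I_k) := l2 (below i) (fun l => dot (uh i) (z l)).
pose t' (i : 'I_k) := l2 (below i) (fun l => dot (z l) (E *m uh i)).
have step i : P i -> X i <= 7 / 2 * b i + 60 * (om * F * b i) + (t i + t' i) / 20 /\
    nrm (J *m hvec i) <= (X i + (X i + t' i + 2 * t i) / 5 / 10 ^+ 3) / gp + 101 / 100 * F * t i.
  by move=> Pi; have [a1 a2] := IHi i Pi; exact: step_bound.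
have bP : l2 P b <= F by apply: le_trans uh_F; exact: l2_sub.
have tP : l2 P t <= B by apply: le_trans (l2_below_le _ _) IHz.
have t'P : l2 P t' <= 3 * B.
  have -> : t' = fun i => l2 (below i) (fun l => dot (uh i) (E *m z l)).
    apply/funext => i; rewrite /t'; congr Num.sqrt; apply: eq_bigr => l _.
    by rewrite (dot_symMC _ _ E_sym).
  apply: le_trans (l2_below_le _ _) _.
  apply: le_trans (_ : l2 (below m) (fun l => 3 * nrm (z l)) <= _).
    by apply: le_l2 => l _; rewrite nrm_ge0 nrm_E_le.
  by rewrite l2Z // ler_pM2l.
have XP : l2 P X <= B.
  pose c0 := 7 / 2 + 60 * (om * F).
  have c00 : 0 <= c0 by have a := mulr_ge0 o0 F0; rewrite /c0; lraw a.
  apply: le_trans (_ : l2 P (fun i => c0 * b i + (1 / 20 * t i + 1 / 20 * t' i)) <= _).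
    apply: le_l2 => i Pi; rewrite nrm_ge0; have [a _] := step i Pi.
    by rewrite /c0; lraw a.
  apply: le_trans (l2D _ _ _) _; rewrite l2Z //.
  have a1 := l2D P (fun i => 1 / 20 * t i) (fun i => 1 / 20 * t' i).
  have v0 : (0 : R) <= 1 / 20 by lraw.
  rewrite !(l2Z _ _ v0) in a1.
  have a2 := ler_wpM2l c00 bP.
  (* Origin of [B]: the sums of [t] and [t'] are at most B and 3 B, so their feedback divided by 20
     takes B / 5. The other 4/5 of B must cover 7/2 F + 60 om F^2; indeed 4/5 * 9/2 >= 7/2 and 4/5 *
     75 = 60. *)
  have a3 : c0 * F <= 4 / 5 * B.
    have F2 := mulr_ge0 o0 (sqr_ge0 F); rewrite /c0 BE; lraw F2 F0.
  lraw a1 a2 a3 tP t'P.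
split.
  apply: le_trans XP; apply: le_l2 => i Pi; rewrite nrm_ge0.
  by have [a1 a2] := IHi i Pi; exact: nrm_z_le.
pose d1 := (1 + 1 / 5 / 10 ^+ 3) / gp.
pose d2 := 1 / 5 / 10 ^+ 3 / gp.
pose d3 := 1 / 25 / 10 ^+ 2 / gp + 101 / 100 * F.
have gi : 0 <= gp^-1 by rewrite invr_ge0 ltW.
have d10 : 0 <= d1 by rewrite /d1; lraw gi.
have d20 : 0 <= d2 by rewrite /d2; lraw gi.
have d30 : 0 <= d3 by rewrite /d3; lraw gi F0.
apply: le_trans (_ : l2 P (fun i => d1 * X i + (d2 * t' i + d3 * t i)) <= _).
  apply: le_l2 => i Pi; rewrite nrm_ge0; have [_ a] := step i Pi.
  by apply: le_trans a _; rewrite /d1 /d2 /d3; lraw gi.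
apply: le_trans (l2D _ _ _) _.
have a1 := l2D P (fun i => d2 * t' i) (fun i => d3 * t i).
rewrite !l2Z // in a1 *.
have b1 := ler_wpM2l d10 XP; have b2 := ler_wpM2l d20 t'P.
have b3 := ler_wpM2l d30 tP; have gB := mulr_ge0 gi B0.
move: b1 b2 b3; rewrite /d1 /d2 /d3 => b1 b2 b3.
apply: le_trans (lerD b1 (le_trans a1 (lerD b2 b3))) _.
lraw gB.
Qed.

Lemma sweep_bound :
  l2 predT (fun i => nrm (J *m hvec i)) <=
    501 / 500 * B / gp + 101 / 100 * F * B /\
  forall c, (1 - B) * l2 predT c <= nrm (\sum_l c l *: hvec l).
Proof.
have [a1 a2] := sweep_l2 k.
have e (a : 'I_k -> R) : l2 predT a = l2 (below k) a.
  by rewrite /l2; congr Num.sqrt; apply: eq_bigl => i; rewrite /below ltn_ord.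
by split=> [|c]; [rewrite e|apply: comb_lower_gen; rewrite e].
Qed.

End Sweep.

(** * Eigendecompositions and Ritz spaces *)

Lemma dot_colV (R : realType) (n p : nat) (V : 'M[R]_(n, p)) j x : dot (col j V) x = (V^T *m x) j 0.
Proof. by rewrite dotE mxE; apply: eq_bigr => i _; rewrite !mxE. Qed.

Lemma dot_col (R : realType) (n p : nat) (V : 'M[R]_(n, p)) i j :
  V^T *m V = 1%:M -> dot (col i V) (col j V) = (i == j)%:R.
Proof.
move=> hV; rewrite dot_colV; have := congr1 (fun M : 'M_p => M i j) hV; rewrite !mxE => <-.
by apply: eq_bigr => l _; rewrite !mxE.
Qed.

Section Spec.
Variables (R : realType) (n : nat) (V : 'M[R]_n).
Hypothesis hV : V^T *m V = 1%:M.
Implicit Types (d e : 'I_n -> R) (x y : 'cV[R]_n).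

(** Functional calculus in the basis [V]: it yields both [A] (up to scaling) and the projection V2
    V2^T, as commuting matrices. *)
Definition spec d : 'M[R]_n := V *m diag_mx (\row_j d j) *m V^T.

Lemma parseval x y : dot x y = \sum_j dot (col j V) x * dot (col j V) y.
Proof.
have VV : V *m V^T = 1%:M by exact: mulmx1C.
rewrite -[y in LHS]mul1mx -VV -mulmxA dotM dotE.
by apply: eq_bigr => j _; rewrite !dot_colV.
Qed.

Lemma dot_col_spec d j x : dot (col j V) (spec d *m x) = d j * dot (col j V) x.
Proof.
rewrite !dot_colV /spec !mulmxA hV mul1mx -mulmxA.
by rewrite mul_diag_mx !mxE.
Qed.

Lemma dot_spec d x y :
  dot x (spec d *m y) = \sum_j d j * (dot (col j V) x * dot (col j V) y).
Proof.
by rewrite parseval; apply: eq_bigr => j _; rewrite dot_col_spec mulrCA.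
Qed.

Lemma spec_sym d : (spec d)^T = spec d.
Proof. by rewrite /spec !trmx_mul trmxK tr_diag_mx mulmxA. Qed.

Lemma spec_mul d e : spec d *m spec e = spec (fun j => d j * e j).
Proof.
rewrite /spec !mulmxA -(mulmxA (V *m _) V^T V) hV mulmx1 -(mulmxA V).
congr (_ *m _ *m _); apply/matrixP => i j; rewrite mul_diag_mx !mxE.
by rewrite -mulrnAr.
Qed.

Lemma eq_spec d e : d =1 e -> spec d = spec e.
Proof.
by move=> de; congr (_ *m diag_mx _ *m _); apply/rowP => j; rewrite !mxE.
Qed.

Lemma spec_comm d e : spec d *m spec e = spec e *m spec d.
Proof. by rewrite !spec_mul; apply: eq_spec => j; rewrite mulrC. Qed.

Lemma spec_quad_le d x a : (forall j, d j <= a) ->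
  dot x (spec d *m x) <= a * dot x x.
Proof.
move=> da; rewrite dot_spec (parseval x x) mulr_sumr; apply: ler_sum => j _.
by rewrite ler_wpM2r // -expr2 sqr_ge0.
Qed.

Lemma spec_quad_ge d x a : (forall j, a <= d j) ->
  a * dot x x <= dot x (spec d *m x).
Proof.
move=> da; rewrite dot_spec (parseval x x) mulr_sumr; apply: ler_sum => j _.
by rewrite ler_wpM2r // -expr2 sqr_ge0.
Qed.

End Spec.

Section Ritz.
Variables (R : realType) (n k : nat) (V : 'M[R]_n) (lam : nat -> R).
Variables (uh : 'I_k -> 'cV[R]_n) (lh : 'I_k -> R) (F : R).
Hypothesis k0 : (0 < k)%N.
Hypothesis kn : (k < n)%N.
Hypothesis hV : V^T *m V = 1%:M.
Hypothesis hlam : forall i j : nat,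
  (1 <= i)%N -> (i <= j)%N -> (j <= n)%N -> lam j <= lam i.

Definition specA := spec V (fun j => lam j.+1).
Definition specJ := spec V (fun j : 'I_n => (k <= j)%N%:R).
Local Notation A := specA.
Local Notation J := specJ.
Local Notation v l := (col l V).
Local Notation om := (lam 1%N - lam n).

Hypothesis uh_on : forall i j, dot (uh i) (uh j) = (i == j)%:R.
Hypothesis Auh : forall i j, dot (uh i) (A *m uh j) = lh j * (i == j)%:R.
Hypothesis lh_dec : forall i j : 'I_k, (i <= j)%N -> lh j <= lh i.
Hypothesis F_ge0 : 0 <= F.
Hypothesis FE : \sum_j dot (J *m uh j) (J *m uh j) = F ^+ 2.

Lemma lam_le1 (l : 'I_n) : lam l.+1 <= lam 1%N.
Proof. exact: hlam. Qed.
Lemma lam_gen (l : 'I_n) : lam n <= lam l.+1.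
Proof. exact: hlam. Qed.
Lemma lam_lek (l : 'I_n) : (k <= l)%N -> lam l.+1 <= lam k.+1.
Proof. by move=> kl; exact: hlam. Qed.
Lemma lam_gek (l : 'I_n) : (l < k)%N -> lam k <= lam l.+1.
Proof. by move=> kl; apply: hlam => //; exact: ltnW. Qed.
Lemma lam_k_k1 : lam k.+1 <= lam k.
Proof. by apply: hlam => //; exact: leqW. Qed.
Lemma lam_n_k : lam n <= lam k.
Proof. by apply: hlam => //; exact: ltnW. Qed.
Lemma lam_k_1 : lam k <= lam 1%N.
Proof. by apply: hlam => //; exact: ltnW. Qed.

Lemma sqr_specJ : J *m J = J.
Proof.
by rewrite spec_mul //; apply: eq_spec => j; rewrite -natrM mulnb andbb.
Qed.

Lemma dot_J x : dot (J *m x) (J *m x) = \sum_(l : 'I_n | (k <= l)%N) dot (v l) x ^+ 2.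
Proof.
rewrite (dot_symM _ _ (spec_sym _ _)) mulmxA sqr_specJ dotC dot_spec //.
rewrite [RHS]big_mkcond; apply: eq_bigr => l _; rewrite expr2.
by case: (k <= l)%N; rewrite ?mul1r ?mul0r.
Qed.

Lemma dot_split x : dot x x =
  \sum_(l : 'I_n | (k <= l)%N) dot (v l) x ^+ 2
  + \sum_(l : 'I_n | ~~ (k <= l)%N) dot (v l) x ^+ 2.
Proof.
rewrite (parseval hV) (bigID (fun l : 'I_n => k <= l)%N) /=.
by congr (_ + _); apply: eq_bigr => l _; rewrite expr2.
Qed.

Lemma dot_J' x : dot (x - J *m x) (x - J *m x)
  = \sum_(l : 'I_n | ~~ (k <= l)%N) dot (v l) x ^+ 2.
Proof.
have := dot_split x; rewrite -dot_J => e.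
have JJx : dot x (J *m x) = dot (J *m x) (J *m x).
  by rewrite [RHS]dot_symM ?spec_sym // mulmxA sqr_specJ dotC.
by rewrite !dotBl !dotBr (dotC (J *m x) x) JJx e; ring.
Qed.

(** Squared length of the projection of the eigenvector [v l] on the Ritz space. *)
Definition wt (l : 'I_n) : R := \sum_j dot (uh j) (v l) ^+ 2.

Lemma comb_dot (a b : 'I_k -> R) :
  dot (\sum_j a j *: uh j) (\sum_j b j *: uh j) = \sum_j a j * b j.
Proof.
rewrite dot_suml; apply: eq_bigr => i _; rewrite dotZl dot_sumr (bigD1 i) //=.
rewrite dotZr uh_on eqxx mulr1 big1 ?addr0 // => j ji.
by rewrite dotZr uh_on eq_sym (negPf ji) mulr0.
Qed.

Lemma comb_dotr (a : 'I_k -> R) x :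
  dot (\sum_j a j *: uh j) x = \sum_j a j * dot (uh j) x.
Proof. by rewrite dot_suml; apply: eq_bigr => i _; rewrite dotZl. Qed.

Definition prj x := \sum_j dot (uh j) x *: uh j.

Lemma dot_prj_compl (l : 'I_n) : dot (v l - prj (v l)) (v l - prj (v l)) = 1 - wt l.
Proof.
rewrite !dotBl !dotBr (dotC _ (prj _)) comb_dot comb_dotr dot_col // eqxx.
have -> : \sum_j dot (uh j) (v l) * dot (uh j) (v l) = wt l.
  by apply: eq_bigr => j _; rewrite expr2.
by rewrite subrr subr0.
Qed.

Lemma wt_le1 l : wt l <= 1.
Proof. by have := dot_ge0 (v l - prj (v l)); rewrite dot_prj_compl subr_ge0. Qed.

Lemma wt_ge0 l : 0 <= wt l.
Proof. by apply: sumr_ge0 => j _; rewrite sqr_ge0. Qed.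

Lemma sum_wt_hi : \sum_(l : 'I_n | (k <= l)%N) wt l = F ^+ 2.
Proof.
rewrite -FE exchange_big /=; apply: eq_bigr => j _; rewrite dot_J.
by apply: eq_bigr => l _; rewrite dotC.
Qed.

(** The projection on the Ritz space has trace k, and k indices lie below k: the weight missing on
    V1 is the weight present on V2. *)
Lemma sum_wt_lo : \sum_(l : 'I_n | ~~ (k <= l)%N) (1 - wt l) = F ^+ 2.
Proof.
have tot : \sum_l wt l = k%:R.
  rewrite exchange_big /= -[k in RHS]card_ord -sum1_card natr_sum.
  apply: eq_bigr => j _; have := parseval hV (uh j) (uh j).
  rewrite uh_on eqxx => ->; apply: eq_bigr => l _.
  by rewrite expr2 (dotC (uh j)).
rewrite (bigID (fun l : 'I_n => k <= l)%N) /= in tot.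
rewrite sumrB -sum_wt_hi; suff -> : \sum_(l : 'I_n | ~~ (k <= l)%N) (1 : R) = k%:R.
  by rewrite -tot; ring.
rewrite sumr_const; congr (_ *+ _).
have wi : injective (widen_ord (ltnW kn)) by move=> a b /(congr1 val) /= /val_inj.
rewrite -[RHS]card_ord -(card_imset _ wi); apply: eq_card => l.
rewrite [LHS]unfold_in -ltnNge.
apply/idP/imsetP => [lk|[j _ ->]]; last by rewrite /= ltn_ord.
by exists (Ordinal lk) => //; exact: val_inj.
Qed.

(** Against such an [x], each [v l] may be replaced by its component orthogonal to the Ritz space,
    and for l < k the squared lengths of these components sum to F^2. *)
Lemma perp_lo x : (forall j, dot (uh j) x = 0) ->
  dot (x - J *m x) (x - J *m x) <= F ^+ 2 * dot x x.
Proof.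
move=> px; rewrite dot_J' -sum_wt_lo mulr_suml; apply: ler_sum => l _.
rewrite -dot_prj_compl.
have -> : dot (v l) x = dot (v l - prj (v l)) x.
  rewrite dotBl comb_dotr big1 ?subr0 // => j _.
  by rewrite px mulr0.
exact: dot_sqr_le.
Qed.

Lemma lhE i : lh i = dot (uh i) (A *m uh i).
Proof. by rewrite Auh eqxx mulr1. Qed.

Lemma ritz_le1 i : lh i <= lam 1%N.
Proof.
rewrite lhE; have := spec_quad_le hV (uh i) lam_le1.
by rewrite uh_on eqxx mulr1.
Qed.

Lemma ritz_gen i : lam n <= lh i.
Proof.
rewrite lhE; have := spec_quad_ge hV (uh i) lam_gen.
by rewrite uh_on eqxx mulr1.
Qed.

Lemma om_ge0 : 0 <= om.
Proof. by rewrite subr_ge0 (le_trans lam_n_k lam_k_1). Qed.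

(** A Ritz vector has at most F^2 of its squared length in V2. The loss om F^2 is the one that
    reduces the gap [g] to [gp] later. *)
Lemma ritz_gek i : lam k - om * F ^+ 2 <= lh i.
Proof.
have bF : dot (J *m uh i) (J *m uh i) <= F ^+ 2.
  rewrite -FE (bigD1 i) //= lerDl; apply: sumr_ge0 => j _; exact: dot_ge0.
have := dot_split (uh i); rewrite -dot_J uh_on eqxx => e.
set lo := \sum_(l | _) _ in e; set hi := dot (J *m _) _ in bF e.
have : lam n * hi + lam k * lo <= lh i.
  rewrite lhE /A dot_spec // (bigID (fun l : 'I_n => k <= l)%N) /=.
  rewrite /hi /lo dot_J !mulr_sumr; apply: lerD; apply: ler_sum => l kl.
    by rewrite -expr2 ler_wpM2r ?sqr_ge0 ?lam_gen.
  by rewrite -expr2 ler_wpM2r ?sqr_ge0 // lam_gek // ltnNge.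
have h0 : 0 <= hi by exact: dot_ge0.
have a1 := lam_n_k; have a2 := lam_k_1.
have a3 := ler_wpM2l om_ge0 bF.
have a4 : (lam k - lam n) * hi <= om * hi by rewrite ler_wpM2r // lerD2r.
have loE : lo = 1 - hi by rewrite [1]e addrC addKr.
rewrite loE; lra.
Qed.

Lemma specJ_fixed x : J *m x = x -> forall l : 'I_n, (l < k)%N -> dot (v l) x = 0.
Proof. by move=> <- l lk; rewrite dot_col_spec // leqNgt lk mul0r. Qed.

Lemma specJ_form i gp x : gp <= lh i - lam k.+1 -> J *m x = x ->
  gp * dot x x <= lh i * dot x x - dot x (A *m x) <= om * dot x x.
Proof.
move=> hg /specJ_fixed Jx; rewrite dot_spec // (parseval hV x x) !mulr_sumr -sumrB.
have H (l : 'I_n) : let d := dot (v l) x * dot (v l) x in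
    gp * d <= lh i * d - lam l.+1 * d <= om * d.
  have [lk|kl] := ltnP l k; first by rewrite Jx //= !(mul0r,mulr0) subr0 lexx.
  rewrite /= -expr2 -mulrBl !ler_wpM2r ?sqr_ge0 //.
    by have := ritz_le1 i; have := lam_gen l; lra.
  by have := lam_lek kl; lra.
by apply/andP; split; apply: ler_sum => l _; case/andP: (H l).
Qed.

(** The residual is orthogonal to the Ritz space, so by [perp_lo] its V1 part is at most F |r|; its
    V2 part is at most om |J uh_i|. The V1 part is thus of second order. *)
Lemma resid_bound i (r := A *m uh i - lh i *: uh i) : F <= 1 / 100 ->
  nrm (r - J *m r) <= 101 / 100 * om * F * nrm (J *m uh i).
Proof.
move=> F1; have o0 := om_ge0.
have rp j : dot (uh j) r = 0.
  rewrite /r dotBr dotZr Auh uh_on; exact: subrr.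
have vr l : dot (v l) r = (lam l.+1 - lh i) * dot (v l) (uh i).
  by rewrite /r dotBr dotZr dot_col_spec // mulrBl.
have Jr : dot (J *m r) (J *m r) <= om ^+ 2 * dot (J *m uh i) (J *m uh i).
  rewrite !dot_J mulr_sumr; apply: ler_sum => l _; rewrite vr exprMn.
  apply: ler_wpM2r; rewrite ?sqr_ge0 //.
  rewrite -[leLHS]real_normK ?num_real // ler_sqr ?nnegrE // ler_norml.
  have := ritz_le1 i; have := ritz_gen i; have := lam_le1 l; have := lam_gen l.
  by move=> *; apply/andP; split; lra.
have lo := perp_lo rp.
have rr : dot r r = dot (J *m r) (J *m r) + dot (r - J *m r) (r - J *m r).
  by rewrite dot_J dot_J' -dot_split.
apply: nrm_le.
  by have a := mulr_ge0 (mulr_ge0 o0 F_ge0) (nrm_ge0 (J *m uh i)); lra.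
set b2 := dot (J *m uh i) _ in Jr; 
have -> : (101 / 100 * om * F * nrm (J *m uh i)) ^+ 2
  = (101 / 100) ^+ 2 * (F ^+ 2 * (om ^+ 2 * b2)) by rewrite /b2 -sqr_nrm; ring.
set s := dot (r - _) _ in lo rr *; set t := dot (J *m r) _ in Jr rr.
rewrite rr in lo.
have F2 : F ^+ 2 <= 1 / 100 by have a := ler_wpM2l F_ge0 F1; rewrite expr2; lra.
have F20 := sqr_ge0 F.
have s0 : 0 <= s by exact: dot_ge0.
have a1 := ler_wpM2l F20 Jr; have a2 := ler_wpM2r s0 F2.
have b20 : 0 <= b2 by exact: dot_ge0.
have a3 : 0 <= F ^+ 2 * (om ^+ 2 * b2) by rewrite !mulr_ge0 ?sqr_ge0.
rewrite mulrDr in lo.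
clear - lo a1 a2 a3; move: (F ^+ 2 * t) (F ^+ 2 * s) (F ^+ 2 * _) lo a1 a2 a3.
by move=> x y z *; lra.
Qed.

(* Ky Fan: exchanging one unit vector [x] of the Ritz space for [y] gives again
   [k] orthonormal vectors, whose trace is at most [lam 1 + ... + lam k]. *)
Lemma exchange_le (a : 'I_k -> R) (sigma : R) y :
  \sum_j a j ^+ 2 = 1 -> dot y y = 1 ->
  (forall j, dot (uh j) y = sigma * a j) ->
  dot y (A *m y) - dot (\sum_j a j *: uh j) (A *m (\sum_j a j *: uh j))
    <= om * F ^+ 2.
Proof.
move=> a1 y1 ya; set x := \sum_j _.
have xx : dot x x = 1 by rewrite comb_dot -a1; apply: eq_bigr => j _; rewrite expr2.
pose d l := dot (v l) y ^+ 2 - dot (v l) x ^+ 2.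
have xv l : dot (v l) x = \sum_j a j * dot (uh j) (v l) by rewrite dotC comb_dotr.
(* [wt l + d l] is the weight of [v l] after the exchange; [dhi] and [dlo] place it between 0 and 1.
   Here [u] is the projection of [v l] on the Ritz vectors orthogonal to [x], hence orthogonal to
   [y], and the bound is Bessel for [u] and [y]. *)
have dhi l : d l <= 1 - wt l.
  pose m := dot (v l) x.
  pose u := \sum_j (dot (uh j) (v l) - m * a j) *: uh j.
  have yu : dot u y = 0.
    rewrite comb_dotr; under eq_bigr do rewrite ya mulrBl.
    rewrite sumrB; have -> : \sum_j dot (uh j) (v l) * (sigma * a j) = sigma * m.
      by rewrite /m xv mulr_sumr; apply: eq_bigr => j _; ring.
    have -> : \sum_j m * a j * (sigma * a j) = sigma * m * \sum_j a j ^+ 2.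
      by rewrite mulr_sumr; apply: eq_bigr => j _; ring.
    by rewrite a1 mulr1 subrr.
  have mE : \sum_j a j * dot (uh j) (v l) = m by rewrite /m xv.
  have uv : dot u (v l) = wt l - m ^+ 2.
    rewrite comb_dotr; have -> : m ^+ 2 = \sum_j m * (a j * dot (uh j) (v l)).
      by rewrite -mulr_sumr mE expr2.
    by rewrite -sumrB; apply: eq_bigr => j _; ring.
  have uu : dot u u = wt l - m ^+ 2.
    rewrite comb_dot.
    have -> : wt l - m ^+ 2 = wt l - 2 * m * \sum_j a j * dot (uh j) (v l)
       + m ^+ 2 * \sum_j a j ^+ 2 by rewrite mE a1; ring.
    rewrite !mulr_sumr -sumrB -big_split; apply: eq_bigr => j _ /=; ring.
  have := dot_ge0 (v l - (u + dot (v l) y *: y)).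
  rewrite !dotlin dot_col // eqxx (dotC y u) (dotC y (v l)) (dotC (v l) u).
  rewrite yu uv uu y1 /d -/m. move=> /= h; lra.
have dlo l : - wt l <= d l.
  have : dot (v l) x ^+ 2 <= wt l.
    have := l2_sum_le predT a (fun j => dot (uh j) (v l)); rewrite -xv.
    have -> : l2 predT a = 1 by rewrite /l2 a1 sqrtr1.
    rewrite mul1r => h; rewrite -[leLHS]real_normK ?num_real //.
    rewrite -[leRHS](sqr_l2 predT) ler_sqr ?nnegrE ?l2_ge0 //.
  by rewrite /d; have := sqr_ge0 (dot (v l) y); lra.
have dsum : \sum_l d l = 0.
  have sq t : \sum_l dot (v l) t ^+ 2 = dot t t.
    by rewrite (parseval hV t t); apply: eq_bigr => l _; rewrite expr2.
  by rewrite sumrB !sq xx y1 subrr.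
(* As the [d l] sum to 0, all eigenvalues may be shifted by [lam k]; the coefficients then have a
   constant sign on each side of index k. *)
have -> : dot y (A *m y) - dot x (A *m x) = \sum_(l < n) (lam l.+1 - lam k) * d l.
  under eq_bigr do rewrite mulrBl.
  rewrite sumrB -mulr_sumr dsum mulr0 subr0 !dot_spec // -sumrB.
  by apply: eq_bigr => l _; rewrite /d -!expr2 mulrBr.
rewrite (bigID (fun l : 'I_n => k <= l)%N) /=.
have -> : om * F ^+ 2 = (lam k - lam n) * F ^+ 2 + (lam 1%N - lam k) * F ^+ 2 by ring.
apply: lerD.
  rewrite -{1}sum_wt_hi mulr_sumr; apply: ler_sum => l kl.
  have c1 := lam_lek kl; have c2 := lam_k_k1; have c3 := lam_gen l.
  have c4 : 0 <= lam k - lam l.+1 by lra.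
  have c5 : 0 <= lam l.+1 - lam n by lra.
  have := ler_wpM2l c4 (dlo l); have := mulr_ge0 c5 (wt_ge0 l); lra.
rewrite -{1}sum_wt_lo mulr_sumr; apply: ler_sum => l kl.
have kl' : (l < k)%N by rewrite ltnNge.
have c1 := lam_gek kl'; have c3 := lam_le1 l.
have c4 : 0 <= lam l.+1 - lam k by lra.
have c5 : 0 <= lam 1%N - lam l.+1 by lra.
have c6 : 0 <= 1 - wt l by rewrite subr_ge0 wt_le1.
have := ler_wpM2l c4 (dhi l); have := mulr_ge0 c5 c6; lra.
Qed.

Lemma ritz_form (a : 'I_k -> R) :
  dot (\sum_j a j *: uh j) (A *m (\sum_j a j *: uh j)) = \sum_j lh j * a j ^+ 2.
Proof.
rewrite dot_suml; apply: eq_bigr => i _.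
rewrite dotZl mulmx_sumr dot_sumr (bigD1 i) //= big1 => [|j ji].
  by rewrite -scalemxAr dotZr Auh eqxx mulr1 addr0; ring.
by rewrite -scalemxAr dotZr Auh eq_sym (negPf ji) !mulr0.
Qed.

(** Exchange the normalised [y] for the direction of its projection on the Ritz space. That
    direction uses only Ritz vectors of index at least i, so its Rayleigh quotient is at most
    [lh i]. *)
Lemma ritz_rayleigh (i : 'I_k) y :
  (forall l : 'I_k, (l < i)%N -> dot (uh l) y = 0) ->
  dot y (A *m y) <= (lh i + om * F ^+ 2) * dot y y.
Proof.
move=> py; have [->|y0] := eqVneq y 0; first by rewrite mulmx0 !dot0l mulr0.
pose ny := nrm y.
have nyp : 0 < ny.
  rewrite lt_def nrm_ge0 andbT; apply: contra_neq y0 => e.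
  by apply: dot_eq0; rewrite -sqr_nrm -/ny e expr0n.
have [y' [yE y1]] : exists y', y = ny *: y' /\ dot y' y' = 1.
  exists (ny^-1 *: y); rewrite scalerA divff ?scale1r ?gt_eqF //; split=> //.
  by rewrite !dotZ -sqr_nrm -/ny; field; rewrite gt_eqF.
suff H : dot y' (A *m y') <= lh i + om * F ^+ 2.
  rewrite {1 2 3 4}yE -scalemxAr !dotZ y1 mulr1.
  by have a := ler_wpM2l (sqr_ge0 ny) H; lra.
have py' (l : 'I_k) : (l < i)%N -> dot (uh l) y' = 0.
  move=> li; have := py l li; rewrite {1}yE dotZr => /eqP.
  by rewrite mulf_eq0 gt_eqF //= => /eqP.
suff [a [sigma [a1 ya ai]]] : exists a sigma, [/\ \sum_j a j ^+ 2 = 1,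
    forall j, dot (uh j) y' = sigma * a j & forall j : 'I_k, (j < i)%N -> a j = 0].
  have := exchange_le a1 y1 ya; rewrite ritz_form.
  suff : \sum_j lh j * a j ^+ 2 <= lh i by lra.
  rewrite -[leRHS]mulr1 -a1 mulr_sumr; apply: ler_sum => j _.
  have [ji|ij] := ltnP j i; first by rewrite ai // expr0n /= !mulr0.
  by rewrite ler_wpM2r ?sqr_ge0 // lh_dec.
pose c j := dot (uh j) y'.
(* If [y'] is orthogonal to the whole Ritz space, any of its unit vectors may be exchanged, for
   instance [uh i]. *)
have [s0|s0] := eqVneq (l2 predT c) 0.
  exists (fun j => (j == i)%:R), 0; split=> [|j|j ji].
  - rewrite (bigD1 i) //= eqxx expr1n big1 ?addr0 // => j /negPf ->.
    by rewrite expr0n.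
  - rewrite mul0r; have := sqr_l2 predT c; rewrite s0 expr0n /= => /esym e.
    apply/eqP; rewrite -sqrf_eq0; apply/eqP.
    by apply: (psumr_eq0P _ e) => // l _; rewrite sqr_ge0.
  - by case: eqP ji => [->|//]; rewrite ltnn.
exists (fun j => (l2 predT c)^-1 * c j), (l2 predT c); split=> [|j|j ji].
- under eq_bigr do rewrite exprMn.
  by rewrite -mulr_sumr -sqr_l2 -exprMn mulVf // expr1n.
- by rewrite mulrA divff // mul1r.
- by rewrite /c py' // mulr0.
Qed.

End Ritz.

(** * The EPSI step *)

Section Span.
Variables (R : realType) (n k : nat).
Implicit Types (f g : 'I_k -> 'cV[R]_n) (x y : 'cV[R]_n).

Definition inspan f (i : nat) x :=
  exists c : 'I_k -> R, x = \sum_(l : 'I_k | (l < i)%N) c l *: f l.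

Lemma inspan_gen f i (l : 'I_k) : (l < i)%N -> inspan f i (f l).
Proof.
move=> li; exists (fun m => (m == l)%:R).
rewrite (bigD1 l) //= eqxx scale1r big1 ?addr0 // => m /andP[_ /negPf ->].
by rewrite scale0r.
Qed.

Lemma inspanD f i x y : inspan f i x -> inspan f i y -> inspan f i (x + y).
Proof.
move=> [c ->] [d ->]; exists (fun l => c l + d l); rewrite -big_split.
by apply: eq_bigr => l _; rewrite scalerDl.
Qed.

Lemma inspanZ f i a x : inspan f i x -> inspan f i (a *: x).
Proof.
move=> [c ->]; exists (fun l => a * c l); rewrite scaler_sumr.
by apply: eq_bigr => l _; rewrite scalerA.
Qed.

Lemma inspan0 f i : inspan f i 0.
Proof. by exists (fun=> 0); rewrite big1 // => l _; rewrite scale0r. Qed.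

Lemma inspan_sum f i g (P : pred 'I_k) (c : 'I_k -> R) :
  (forall l, P l -> inspan f i (g l)) -> inspan f i (\sum_(l | P l) c l *: g l).
Proof.
move=> H; elim/big_ind: _ => [|x y|l Pl]; [exact: inspan0|exact: inspanD|].
by apply: inspanZ; exact: H.
Qed.

Lemma inspan_sub f i j x : (i <= j)%N -> inspan f i x -> inspan f j x.
Proof.
move=> ij [c ->]; apply: inspan_sum => l li.
by apply: inspan_gen; exact: leq_trans li ij.
Qed.

Lemma inspan_perp f i x y : (forall l : 'I_k, (l < i)%N -> dot (f l) y = 0) ->
  inspan f i x -> dot x y = 0.
Proof.
move=> H [c ->]; rewrite dot_suml big1 // => l li.
by rewrite dotZl H ?mulr0.
Qed.

(** The coefficient [t] may vanish, so this gives one inclusion only; equality of spans needs a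
    triangular relation in each direction. *)
Lemma inspan_trig f g :
  (forall i : 'I_k, exists t x, inspan f i x /\ f i = t *: g i + x) ->
  forall i, forall l : 'I_k, (l < i)%N -> inspan g i (f l).
Proof.
move=> H; suff step m : forall l : 'I_k, (l < m)%N -> inspan g l.+1 (f l).
  by move=> i l li; apply: inspan_sub li _; exact: step (leqnn _).
elim: m => [//|m IH] l lm; have [t [x [[c ->] ->]]] := H l.
apply: inspanD; first by apply: inspanZ; exact: inspan_gen.
apply: inspan_sum => j jl; apply: inspan_sub (leqW jl) _.
by apply: IH; apply: leq_trans jl _; rewrite -ltnS.
Qed.

End Span.

Section Basis.
Variables (R : realType) (n : nat).

Lemma submx_tr_mul m p (X : 'M[R]_(n, m)) (Y : 'M[R]_(n, p)) :
  (X^T <= Y^T)%MS -> exists D : 'M[R]_(p, m), X = Y *m D.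
Proof.
move=> /submxP[D e]; exists D^T.
by apply: trmx_inj; rewrite trmx_mul trmxK.
Qed.

Lemma mul_sum_col p (Y : 'M[R]_(n, p)) (x : 'cV[R]_p) :
  Y *m x = \sum_l x l 0 *: col l Y.
Proof.
apply/matrixP => i j; rewrite (ord1 j) mxE summxE; apply: eq_bigr => l _.
by rewrite !mxE mulrC.
Qed.

Lemma basis_cols_span k (u : 'M[R]_(n, k)) (i : nat) r (U : 'M[R]_(n, r)) x :
  orthonormal_basis U (cols u 1 i) -> inspan (fun l => col l u) i (U *m x).
Proof.
case=> _ /andP[/submx_tr_mul[D ->] _].
pose S : 'M[R]_(k, _) := cols 1%:M 1 i.
have -> : cols u 1 i = u *m S.
  apply/matrixP => a b; rewrite !mxE (bigD1 (enum_val b)) //= !mxE eqxx mulr1.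
  by rewrite big1 ?addr0 // => l lb; rewrite !mxE (negPf lb) mulr0.
rewrite -!mulmxA mul_sum_col; set y := S *m _.
exists (fun l => y l 0); rewrite [RHS]big_mkcond; apply: eq_bigr => l _.
case: ifPn => // il; suff -> : y l 0 = 0 by rewrite scale0r.
rewrite mxE big1 // => s _; rewrite !mxE.
case: eqP => [e|]; last by rewrite mul0r.
by have := enum_valP s; rewrite -e inE /= (negPf il).
Qed.

Lemma basis_cols_fix k (u : 'M[R]_(n, k)) (i : nat) r (U : 'M[R]_(n, r)) (l : 'I_k) :
  orthonormal_basis U (cols u 1 i) -> (l < i)%N ->
  U *m U^T *m col l u = col l u.
Proof.
case=> oU /andP[_ /submx_tr_mul[D e]] li.
have Al : l \in [pred l : 'I_k | (1 <= l.+1 <= i)%N] by [].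
have -> : col l u = col (enum_rank_in Al l) (cols u 1 i).
  by apply/matrixP => a b; rewrite !mxE enum_rankK_in.
by rewrite e colE !mulmxA -(mulmxA U) oU mulmx1.
Qed.

End Basis.

Section Epsi.
Variables (R : realType) (n k : nat) (A Ahat : 'M[R]_n).
Variables (uhat u' : 'M[R]_(n, k)) (lh : 'I_k -> R).
Hypothesis lhE : forall i, lh i = dot (col i uhat) (A *m col i uhat).
Hypothesis step : epsi_step A Ahat uhat u'.

(** With [w] the unnormalised iterate and [P] the deflation, take z = P w - P uh, so that uh + z
    equals w modulo the earlier iterates. Testing (M - lh) w = (M - A) uh against y = P y, the terms
    in Ahat P uh cancel and only Ahat z remains. *)
Lemma epsi_vector (i : 'I_k) : exists z : 'cV[R]_n,
  [/\ forall l : 'I_k, (l < i)%N -> dot (col l u') z = 0,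
      forall y, (forall l : 'I_k, (l < i)%N -> dot (col l u') y = 0) ->
        lh i * dot y (col i uhat + z) - dot y (A *m (col i uhat + z))
          + dot y ((A - Ahat) *m z) = 0,
      exists t x, inspan (fun l => col l u') i x /\
        col i uhat + z = t *: col i u' + x,
      exists t x, inspan (fun l => col l u') i x /\
        col i u' = t *: (col i uhat + z) + x
    & forall x, exists q, inspan (fun l => col l u') i q /\
        forall l : 'I_k, (l < i)%N -> dot (col l u') (x - q) = 0].
Proof.
have [r [U [bU uM uE]]] := step i.
set uh := col i uhat in uE *.
have lE : (uh^T *m A *m uh) 0 0 = lh i by rewrite lhE /dot mulmxA.
rewrite lE in uM uE.
set Q := U *m U^T; set P := 1%:M - Q in uM uE.
set M := P *m Ahat *m P in uM uE.
set w := invmx _ *m _ *m _ in uE.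
have Qs : Q^T = Q by rewrite /Q trmx_mul trmxK.
have Ps : P^T = P by rewrite /P linearB /= trmx1 Qs.
have oU : U^T *m U = 1%:M by case: bU.
have QQ : Q *m Q = Q by rewrite /Q mulmxA -(mulmxA U) oU mulmx1.
have Qspan x : inspan (fun l => col l u') i (Q *m x).
  by rewrite /Q -mulmxA; exact: basis_cols_span.
have Pu (l : 'I_k) : (l < i)%N -> P *m col l u' = 0.
  by move=> li; rewrite /P mulmxBl mul1mx (basis_cols_fix bU li) subrr.
have wE : (M - (lh i)%:M) *m w = (M - A) *m uh.
  by rewrite /w !mulmxA mulmxV // mul1mx.
have PE x : P *m x = x - Q *m x by rewrite /P mulmxBl mul1mx.
pose z := P *m w - P *m uh.
have hE : uh + z = w + Q *m (uh - w).
  have shuffle (a b c d : 'cV[R]_n) : a + (b - c - (a - d)) = b + (d - c).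
    by apply/matrixP => s t; rewrite !mxE; ring.
  by rewrite /z !PE mulmxBr shuffle.
exists z; split.
- by move=> l li; rewrite /z -mulmxBr dot_symM // Pu // dot0l.
- move=> y py; have Py : P *m y = y.
    suff Qy : Q *m y = 0 by rewrite PE Qy subr0.
    apply: dot_eq0; rewrite -dot_symM // mulmxA QQ dotC.
    exact: inspan_perp py (Qspan y).
  have yP x : dot y (P *m x) = dot y x by rewrite dot_symM // Py.
  have yM x : dot y (M *m x) = dot y (Ahat *m (P *m x)).
    by rewrite /M -!mulmxA yP.
  have Pw : P *m w = z + P *m uh by rewrite subrK.
  have yw : dot y w = dot y z + dot y uh by rewrite -(yP w) Pw dotDr yP.
  have := congr1 (dot y) wE; clearbody z.
  rewrite (mulmxBl M _ w) (mulmxBl M A uh) mul_scalar_mx !dotBr dotZr !yM Pw.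
  rewrite mulmxDr (mulmxDr A) (mulmxBl A Ahat z) !dotDr (dotNr y (Ahat *m z)) yw => e.
  by clear - e; lra.
- exists (vnorm2 w), (Q *m (uh - w)); split=> //.
  rewrite hE uE scalerA; congr (_ + _).
  (* If [w] vanishes, both sides are 0 whatever the inverse of its norm. *)
  have [w0|w0] := eqVneq (vnorm2 w) 0; last by rewrite divff ?scale1r.
  have -> : w = 0 by apply: dot_eq0; rewrite -sqr_nrm /nrm w0 expr0n.
  by rewrite scaler0.
- exists (vnorm2 w)^-1, (- (vnorm2 w)^-1 *: (Q *m (uh - w))); split.
    exact: inspanZ.
  by rewrite uE hE scalerDr scaleNr addrK.
- move=> x; exists (Q *m x); split=> // l li.
  by rewrite -PE dot_symM // Pu // dot0l.
Qed.

(** The vectors [h l] and the normalised iterates satisfy triangular relations in both directions,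
    hence span the same nested spaces; every orthogonality condition can then be stated with [h]
    alone. *)
Lemma epsi_vectors : exists z : 'I_k -> 'cV[R]_n,
  let h i := col i uhat + z i in
  [/\ forall i l : 'I_k, (l < i)%N -> dot (h l) (z i) = 0,
      forall (i : 'I_k) y, (forall l : 'I_k, (l < i)%N -> dot (h l) y = 0) ->
        lh i * dot y (h i) - dot y (A *m h i) + dot y ((A - Ahat) *m z i) = 0,
      forall (i : 'I_k) x, exists c : 'I_k -> R, forall l : 'I_k, (l < i)%N ->
        dot (h l) (x - \sum_(m : 'I_k | (m < i)%N) c m *: h m) = 0
    & exists D : 'M[R]_k, u' = (\matrix_(a, j) h j a 0) *m D].
Proof.
have [z zP] := choice epsi_vector; exists z => h.
have hu i : forall l : 'I_k, (l < i)%N -> inspan (fun l => col l u') i (h l).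
  move=> l li; have [_ _ [t [x [xs e]]] _ _] := zP l; rewrite /h e.
  apply: inspanD; last exact: inspan_sub (ltnW li) xs.
  by apply: inspanZ; exact: (@inspan_gen _ _ _ (fun l => col l u')).
have trig (j : 'I_k) : exists t x, inspan (fun l => col l u') j x /\ col j u' = t *: h j + x.
  by have [_ _ _ H _] := zP j; exact: H.
have uh i : forall l : 'I_k, (l < i)%N -> inspan h i (col l u').
  by apply: inspan_trig => j; exact: trig.
have hp (i : nat) (y : 'cV[R]_n) : (forall l : 'I_k, (l < i)%N -> dot (col l u') y = 0) ->
    forall l : 'I_k, (l < i)%N -> dot (h l) y = 0.
  by move=> H l li; exact: inspan_perp H (hu i l li).
have ph (i : nat) (y : 'cV[R]_n) : (forall l : 'I_k, (l < i)%N -> dot (h l) y = 0) ->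
    forall l : 'I_k, (l < i)%N -> dot (col l u') y = 0.
  by move=> H l li; exact: inspan_perp H (uh i l li).
split.
- by move=> i l li; have [H _ _ _ _] := zP i; exact: (hp i).
- by move=> i y py; have [_ H _ _ _] := zP i; apply: H; exact: ph.
- move=> i x; have [_ _ _ _ /(_ x) [q [[d qE] pq]]] := zP i.
  have [c cE] : inspan h i q by rewrite qE; apply: inspan_sum => l li; exact: uh.
  by exists c => l li; rewrite -cE; exact: (hp i).
have H (j : 'I_k) := uh k j (ltn_ord j).
have [D DE] := choice H; exists (\matrix_(l, j) D j l).
apply/matrixP => a j; rewrite mxE.
have := congr1 (fun v : 'cV_n => v a 0) (DE j); rewrite mxE => ->.
rewrite summxE; apply: eq_big => [l|l _]; first by rewrite ltn_ord.
by rewrite !mxE mulrC.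
Qed.

End Epsi.

(** * Frobenius and spectral norms *)

Section Frobenius.
Variable R : realType.

Lemma frobnorm_ge0 m n (M : 'M[R]_(m, n)) : 0 <= frobnorm M.
Proof. exact: sqrtr_ge0. Qed.

Lemma sqr_frobnorm m n (M : 'M[R]_(m, n)) :
  frobnorm M ^+ 2 = \sum_j dot (col j M) (col j M).
Proof.
rewrite sqr_sqrtr; last by apply: sumr_ge0 => i _; apply: sumr_ge0 => j _; rewrite sqr_ge0.
rewrite exchange_big; apply: eq_bigr => j _; rewrite dotE.
by apply: eq_bigr => i _; rewrite !mxE expr2.
Qed.

Lemma nrm_mulmx_le m n (M : 'M[R]_(m, n)) x : nrm (M *m x) <= frobnorm M * nrm x.
Proof.
apply: nrm_le; first by rewrite mulr_ge0 ?frobnorm_ge0 ?nrm_ge0.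
rewrite exprMn sqr_nrm sqr_sqrtr; last first.
  by apply: sumr_ge0 => i _; apply: sumr_ge0 => j _; rewrite sqr_ge0.
rewrite dotE mulr_suml; apply: ler_sum => i _.
have := dot_sqr_le (row i M)^T x; rewrite -expr2.
have -> : dot (row i M)^T x = (M *m x) i 0.
  by rewrite dotE mxE; apply: eq_bigr => j _; rewrite !mxE.
rewrite [dot _^T _]dotE; congr (_ <= _ * _).
by apply: eq_bigr => j _; rewrite !mxE expr2.
Qed.

Lemma nrm_le_specnorm m n (M : 'M[R]_(m, n)) x :
  nrm x <= 1 -> nrm (M *m x) <= specnorm M.
Proof.
move=> x1; apply: ub_le_sup; last by exists x.
exists (frobnorm M) => _ [y /= y1 <-].
apply: le_trans (nrm_mulmx_le _ _) _.
by rewrite -[leRHS]mulr1 ler_wpM2l ?frobnorm_ge0.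
Qed.

Lemma specnorm_ge0 m n (M : 'M[R]_(m, n)) : 0 <= specnorm M.
Proof.
by have := @nrm_le_specnorm _ _ M 0; rewrite mulmx0 !nrm0 => -> //; exact: ler01.
Qed.

(** Turns the k |V2^T U_q| of [c0] into sqrt k |V2^T U_q|_F, whose factor sqrt k matches the trivial
    bound. *)
Lemma frobnorm_le_specnorm m k (M : 'M[R]_(m, k)) :
  Num.sqrt k%:R * frobnorm M <= k%:R * specnorm M.
Proof.
have s0 := specnorm_ge0 M.
rewrite -{2}(sqr_sqrtr (ler0n R k)) expr2 -mulrA ler_wpM2l ?sqrtr_ge0 //.
rewrite -ler_sqr ?nnegrE ?frobnorm_ge0 ?mulr_ge0 ?sqrtr_ge0 //.
rewrite sqr_frobnorm.
rewrite (exprMn _ (Num.sqrt _)) sqr_sqrtr ?ler0n //.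
apply: le_trans (_ : \sum_(j < k) specnorm M ^+ 2 <= _).
  apply: ler_sum => j _; rewrite -sqr_nrm ler_sqr ?nnegrE ?nrm_ge0 //.
  rewrite colE; apply: nrm_le_specnorm; rewrite nrmE dotE (bigD1 j) //= big1.
    by rewrite !mxE !eqxx mulr1 addr0 sqrtr1.
  by move=> l /negPf lj; rewrite !mxE lj mul0r.
by rewrite sumr_const card_ord mulr_natl.
Qed.

Variables (n k : nat) (V : 'M[R]_n).
Hypothesis hV : V^T *m V = 1%:M.
Hypothesis kn : (k < n)%N.

Lemma sqr_frobnorm_cols p (X : 'M[R]_(n, p)) :
  frobnorm ((cols V k.+1 n)^T *m X) ^+ 2
  = \sum_j dot (specJ k V *m col j X) (specJ k V *m col j X).
Proof.
rewrite sqr_frobnorm; apply: eq_bigr => j _; rewrite dot_J // dotE.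
(* [cols] numbers columns from 1: column k + 1 has ordinal index k. *)
rewrite (eq_bigl (fun l : 'I_n => (k.+1 <= l.+1 <= n)%N)); last first.
  by move=> l; rewrite ltnS ltn_ord andbT.
rewrite (big_enum_val (A := [pred l : 'I_n | (k.+1 <= l.+1 <= n)%N])
  (fun l : 'I_n => dot (col l V) (col j X) ^+ 2)).
apply: eq_bigr => s _; rewrite -expr2; congr (_ ^+ 2).
rewrite !mxE dotE; apply: eq_bigr => a _; by rewrite !mxE.
Qed.

Lemma frobnorm_cols_le p (X : 'M[R]_(n, p)) : orthonormal_cols X ->
  frobnorm ((cols V k.+1 n)^T *m X) <= Num.sqrt p%:R.
Proof.
move=> oX; rewrite -ler_sqr ?nnegrE ?frobnorm_ge0 ?sqrtr_ge0 //.
rewrite sqr_frobnorm_cols sqr_sqrtr ?ler0n //.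
apply: le_trans (_ : \sum_(j < p) (1 : R) <= _).
  apply: ler_sum => j _; apply: le_trans (_ : dot (col j X) (col j X) <= _).
    rewrite (dot_split k hV (col j X)) dot_J // lerDl.
    by apply: sumr_ge0 => l _; rewrite sqr_ge0.
  by rewrite dot_col // eqxx.
by rewrite sumr_const card_ord.
Qed.

Lemma frobnorm_cols_rows p (X : 'M[R]_(n, p)) :
  frobnorm ((cols V k.+1 n)^T *m X) ^+ 2
  = \sum_(l : 'I_n | (k <= l)%N) dot (X^T *m col l V) (X^T *m col l V).
Proof.
rewrite sqr_frobnorm_cols; under eq_bigr do rewrite dot_J //.
rewrite exchange_big /=; apply: eq_bigr => l _; rewrite dotE.
apply: eq_bigr => j _; rewrite -expr2; congr (_ ^+ 2).
by rewrite mxE dotC dotE; apply: eq_bigr => a _; rewrite !mxE.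
Qed.

(** Row by row, [C] acts by its transpose, which inherits the bound [t] by duality. *)
Lemma frobnorm_cols_mul p q (X : 'M[R]_(n, p)) (C : 'M[R]_(p, q)) (t : R) : 0 <= t ->
  (forall x, nrm (C *m x) <= t * nrm x) ->
  frobnorm ((cols V k.+1 n)^T *m (X *m C)) <= t * frobnorm ((cols V k.+1 n)^T *m X).
Proof.
move=> t0 Ct; rewrite -ler_sqr ?nnegrE ?mulr_ge0 ?frobnorm_ge0 //.
rewrite exprMn !frobnorm_cols_rows mulr_sumr; apply: ler_sum => l _.
rewrite trmx_mul -mulmxA; set g := X^T *m _.
rewrite -!sqr_nrm -exprMn ler_sqr ?nnegrE ?mulr_ge0 ?nrm_ge0 //.
have [->|n0] := eqVneq (nrm (C^T *m g)) 0; first by rewrite mulr_ge0 ?nrm_ge0.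
have p0 : 0 < nrm (C^T *m g) by rewrite lt_def n0 nrm_ge0.
rewrite -(ler_pM2l p0) -expr2 sqr_nrm.
have -> : dot (C^T *m g) (C^T *m g) = dot (C *m (C^T *m g)) g.
  by rewrite /dot !trmx_mul !trmxK !mulmxA.
apply: le_trans (dot_le _ _) _; rewrite mulrCA mulrA ler_wpM2r ?nrm_ge0 //.
Qed.

End Frobenius.

(** * One iteration *)

Lemma ler_cube (R : realType) (x y : R) : 0 <= y -> x ^+ 3 <= y ^+ 3 -> x <= y.
Proof.
move=> y0; apply: contraTT; rewrite -!ltNge => yx.
by rewrite ltrXn2r // (le_trans y0 (ltW yx)).
Qed.

Lemma pow4D_le (R : realType) (x y : R) :
  (x + y) ^+ 4 <= 8 * (x ^+ 4 + y ^+ 4).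
Proof.
have a := sqr_ge0 (x - y); have b := sqr_ge0 (x ^+ 2 - y ^+ 2).
have c : (x + y) ^+ 2 <= 2 * (x ^+ 2 + y ^+ 2) by lra.
have d : ((x + y) ^+ 2) ^+ 2 <= (2 * (x ^+ 2 + y ^+ 2)) ^+ 2.
  by rewrite ler_sqr ?nnegrE ?sqr_ge0 // mulr_ge0 // addr_ge0 // sqr_ge0.
lra.
Qed.

(* [L ^+ 2 * F ^+ 3] and [L * om * F ^+ 2 / g ^+ 2] are the two quantities that
   have to be small; if one is not, the right-hand side of the theorem exceeds
   [sqrt k]. *)
Lemma small_params (R : realType) (L om g F : R) (d := 1 / 10 ^+ 5 : R)
    (gp := g - om * F ^+ 2) (B := 9 / 2 * F + 75 * (om * F ^+ 2)) :
  0 <= F -> 49 / 10 <= g -> g <= om -> om <= L ->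
  L ^+ 2 * F ^+ 3 <= d ^+ 3 -> L * om * F ^+ 2 <= d ^+ 2 * g ^+ 2 ->
  [/\ F <= 1 / 10 ^+ 4, B <= 1 / 10 ^+ 4, L * F ^+ 2 <= 1 / 10 ^+ 4
    & L * B ^+ 4 <= 1 / 10 ^+ 4] /\
  [/\ om * F <= gp / 10 ^+ 4, om * F ^+ 2 <= 1 / 10 ^+ 5
    & 999 / 10 ^+ 3 * g <= gp].
Proof.
move=> F0 g49 gom omL s1 s2.
have d0 : 0 <= d by rewrite divr_ge0 // exprn_ge0.
have dE : d <= 1 / 10 ^+ 5 by [].
have d100 : 100 * d <= 1 / 10 ^+ 3 by rewrite /d; lra.
clearbody d.
have g0 : 0 <= g by clear - g49; lra.
have L1 : 1 <= L by clear - g49 gom omL; lra.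
have L0 : 0 <= L by clear - L1; lra.
have o0 : 0 <= om by clear - g0 gom; lra.
have F30 : 0 <= F ^+ 3 by exact: exprn_ge0.
have F20 : 0 <= F ^+ 2 by exact: exprn_ge0.
have Fd : F <= d.
  apply: ler_cube => //; apply: le_trans s1.
  by rewrite ler_peMl // exprn_ege1.
pose e := L * F ^+ 2.
have e0 : 0 <= e by rewrite mulr_ge0.
(* With e = L F^2, the left side is exactly (L^2 F^3)^2. *)
have Le3 : L * e ^+ 3 <= (d ^+ 2) ^+ 3.
  have -> : L * e ^+ 3 = (L ^+ 2 * F ^+ 3) ^+ 2 by rewrite /e; ring.
  have -> : (d ^+ 2) ^+ 3 = (d ^+ 3) ^+ 2 by ring.
  by rewrite ler_sqr ?nnegrE ?mulr_ge0 ?exprn_ge0.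
have ed : e <= d ^+ 2.
  apply: ler_cube; first exact: sqr_ge0.
  apply: le_trans Le3; rewrite ler_peMl // exprn_ge0 //.
have d1 : d <= 1 / 10 ^+ 3 by clear - d100 d0; lra.
have dd : d ^+ 2 <= 1 / 10 ^+ 3 * d by rewrite expr2 ler_wpM2r.
have fe : om * F ^+ 2 <= e by rewrite ler_wpM2r.
have oF0 : 0 <= om * F by rewrite mulr_ge0.
(* (om F)^2 <= L om F^2, since om <= L. *)
have omF : om * F <= d * g.
  rewrite -ler_sqr ?nnegrE ?mulr_ge0 // (exprMn _ d).
  apply: le_trans s2; rewrite exprMn ler_wpM2r // expr2 ler_wpM2r //.
have f0 : 0 <= om * F ^+ 2 by rewrite mulr_ge0.
have fd : om * F ^+ 2 <= 1 / 10 ^+ 3 * d by apply: le_trans fe (le_trans ed dd).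
have gpE : 999 / 10 ^+ 3 * g <= gp.
  by rewrite /gp; clear - fd d1 g49 d0; lra.
have B0 : 0 <= B by rewrite /B; clear - F0 f0; lra.
have Bd : B <= 5 * d by rewrite /B; clear - fd Fd d0; lra.
split; split=> //.
- by clear - Fd d100 d0; lra.
- by clear - Bd d100; lra.
- by rewrite -/e; clear - ed dd d100 d0; lra.
(* L B^4 reduces to L F^4 = e F^2 and L e^4 = (L e^3) e, both small without any bound on [L]
   itself. *)
- have Bxy : B <= 75 * F + 75 * e by rewrite /B; clear - fe F0; lra.
  have x0 : 0 <= 75 * F by rewrite mulr_ge0.
  have y0 : 0 <= 75 * e by rewrite mulr_ge0.
  have B4 : B ^+ 4 <= (75 * F + 75 * e) ^+ 4.
    by apply: lerXn2r => //; rewrite nnegrE ?addr_ge0.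
  have := ler_wpM2l L0 (le_trans B4 (pow4D_le _ _)).
  have -> : L * (8 * ((75 * F) ^+ 4 + (75 * e) ^+ 4)) =
     8 * ((75 * (75 * e)) * ((75 * F) * (75 * F))
          + (75 * (75 * (L * e ^+ 3))) * (75 * (75 * e))) by rewrite /e; ring.
  have a1 : 75 * (75 * e) <= 1 / 10 ^+ 2 by clear - ed dd d100 d0; lra.
  have a2 : 75 * F <= 1 / 10 ^+ 3 by clear - Fd d100 d0; lra.
  have d21 : d ^+ 2 <= 1 by clear - dd d1; lra.
  have d6 : (d ^+ 2) ^+ 3 <= d ^+ 2.
    rewrite exprS ler_piMr ?sqr_ge0 // exprn_ile1 ?sqr_ge0 //.
  have a3 : 75 * (75 * (L * e ^+ 3)) <= 1 / 10 ^+ 2.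
    by clear - Le3 d6 dd d100 d0; lra.
  have p1 : 0 <= 75 * (75 * e) by rewrite !mulr_ge0.
  have p3 : 0 <= 75 * (75 * (L * e ^+ 3)) by rewrite !mulr_ge0 ?exprn_ge0.
  have b1 := ler_pM x0 x0 a2 a2.
  have b2 := ler_pM p1 (mulr_ge0 x0 x0) a1 b1.
  have a1' : 75 * (75 * e) <= 1 / 10 ^+ 3 by clear - ed dd d100 d0; lra.
  have a3' : 75 * (75 * (L * e ^+ 3)) <= 1 / 10 ^+ 3.
    by clear - Le3 d6 dd d100 d0; lra.
  have b3 := ler_pM p3 p1 a3' a1'.
  move: b2 b3; move: (75 * (75 * e) * _) (_ * (75 * (75 * e))) => t1 t2 b2 b3 b4.
  by clear - b2 b3 b4; lra.
- by clear - omF gpE d100 d0 g49 g0; have := ler_wpM2r g0 d100; lra.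
- by clear - fd d0 dE; lra.
Qed.

Lemma spec_scale (R : realType) (n : nat) (V : 'M[R]_n) a d :
  spec V (fun j => a * d j) = a *: spec V d.
Proof.
rewrite /spec scalemxAl scalemxAr; congr (_ *m _ *m _).
by rewrite -linearZ; congr diag_mx; apply/rowP => j; rewrite !mxE.
Qed.

Lemma psdmx_dot (R : realType) (n : nat) (M : 'M[R]_n) x :
  psdmx M -> 0 <= dot x (M *m x).
Proof. by move=> [_ /(_ x)]; rewrite /dot mulmxA. Qed.

Lemma isometry_mul (R : realType) (n k : nat) (X Y : 'M[R]_(n, k)) (D : 'M[R]_k) :
  orthonormal_cols X -> orthonormal_cols Y -> X = Y *m D ->
  forall x, nrm (D *m x) <= 1 * nrm x.
Proof.
move=> oX oY e x; rewrite mul1r !nrmE.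
have iso p q (Z : 'M[R]_(p, q)) t : Z^T *m Z = 1%:M -> dot (Z *m t) (Z *m t) = dot t t.
  by move=> oZ; rewrite /dot trmx_mul mulmxA -(mulmxA _ Z^T) oZ mulmx1.
by rewrite -(iso _ _ _ x oX) e -mulmxA (iso _ _ _ (D *m x) oY).
Qed.

Lemma lam_n_ge0 (R : realType) (n : nat) (V : 'M[R]_n) (lam : nat -> R) :
  (0 < n)%N -> orthonormal_cols V ->
  psdmx (spec V (fun j => lam j.+1)) -> 0 <= lam n.
Proof.
move=> n0 hV hA; have n1 : (n.-1 < n)%N by rewrite prednK.
have := psdmx_dot (col (Ordinal n1) V) hA.
by rewrite dot_col_spec // dot_col // eqxx mulr1 /= prednK.
Qed.

(** Nontrivial regime, in units of [eta]. The factors 501/500, 1 / (1 - B) and g / gp raise 9/2 to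
    less than 47/10, and 75 to less than 80. *)
Lemma iteration_bound (R : realType) (n k : nat) (A Ahat V : 'M[R]_n)
    (lam : nat -> R) (eta : R) (u u' Uq Uq1 : 'M[R]_(n, k))
    (V2 := cols V k.+1 n) (F := frobnorm (V2^T *m Uq)) (L := lam 1%N / eta)
    (om := (lam 1%N - lam n) / eta) (g := (lam k - lam k.+1) / eta)
    (d := 1 / 10 ^+ 5 : R) :
  (0 < k)%N -> (k < n)%N -> psdmx A -> orthonormal_cols V ->
  A = V *m diag_mx (\row_(j < n) lam j.+1) *m V^T ->
  (forall i j : nat, (1 <= i)%N -> (i <= j)%N -> (j <= n)%N -> lam j <= lam i) ->
  Ahat^T = Ahat -> 0 < eta -> loewner (A - (3 * eta)%:M) Ahat ->
  loewner Ahat (A - eta%:M) -> lazy_epsi_iter A Ahat u u' ->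
  orthonormal_basis Uq u -> orthonormal_basis Uq1 u' ->
  49 / 10 <= g -> L ^+ 2 * F ^+ 3 <= d ^+ 3 ->
  L * om * F ^+ 2 <= d ^+ 2 * g ^+ 2 ->
  frobnorm (V2^T *m Uq1) <=
    47 / 10 * (F / g) + 80 * (om * F ^+ 2 / g) + 5 * F ^+ 2
    + 80 * (F * (om * F ^+ 2)).
Proof.
move=> k0 kn hA hV hAV hlam hAhat eta0 hlow hupp hiter hUq hUq1 g49 s1 s2.
have [uhat [[U [bU ohat subU [mu [mu_dec mu_eig]]]] step]] := hiter.
set P := U *m U^T in mu_eig.
have oU : U^T *m U = 1%:M by case: bU.
have e0 : 0 < eta^-1 by rewrite invr_gt0.
pose lam' i := lam i / eta.
pose uh i := col i uhat.
pose lh i := mu i / eta.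
have A_sym : A^T = A by case: hA.
have AE : specA V lam' = eta^-1 *: A.
  rewrite hAV -[V *m _ *m _]/(spec V (fun j => lam j.+1)) -spec_scale.
  by apply: eq_spec => j; rewrite mulrC.
have Puh i : P *m uh i = uh i.
  have [D e] := submx_tr_mul subU.
  by rewrite /uh e colE !mulmxA /P -(mulmxA U) oU mulmx1.
have Ps : P^T = P by rewrite /P trmx_mul trmxK.
have uh_on i j : dot (uh i) (uh j) = (i == j)%:R by exact: dot_col.
have Amu i j : dot (uh i) (A *m uh j) = mu j * (i == j)%:R.
  rewrite -uh_on -dotZr -mu_eig -/(uh j).
  rewrite -(mulmxA (P *m A) P (uh j)) Puh -(mulmxA P A (uh j)).
  by rewrite [RHS]dot_symM // Puh.
have Auh i j : dot (uh i) (specA V lam' *m uh j) = lh j * (i == j)%:R.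
  by rewrite AE -scalemxAl dotZr Amu /lh; ring.
have hlam' i j : (1 <= i)%N -> (i <= j)%N -> (j <= n)%N -> lam' j <= lam' i.
  by move=> a b c; rewrite ler_pM2r // hlam.
have lh_dec (i j : 'I_k) : (i <= j)%N -> lh j <= lh i.
  by move=> ij; rewrite ler_pM2r // mu_dec.
(* The sweep is measured from the Ritz vectors, which lie in the range of [Uq], whence F0 <= F; the
   right-hand side is monotone in F. *)
pose F0 := frobnorm (V2^T *m uhat).
have F00 : 0 <= F0 by exact: frobnorm_ge0.
have F0F : F0 <= F.
  have [D e] : exists D, uhat = Uq *m D.
    apply: submx_tr_mul; case: bU => _ /eqmxP bU'; case: hUq => _ /eqmxP bq.
    by rewrite (submx_trans subU) // bU' bq.
  rewrite /F0 e -[leRHS]mul1r; apply: frobnorm_cols_mul => //.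
  by apply: isometry_mul e => //; case: hUq.
have FE : \sum_j dot (specJ k V *m uh j) (specJ k V *m uh j) = F0 ^+ 2.
  by rewrite sqr_frobnorm_cols.
have n0 : 0 <= lam n.
  by apply: lam_n_ge0 hV _; [exact: leq_ltn_trans kn|rewrite /spec -hAV].
have omE : lam' 1%N - lam' n = om by rewrite /om /lam' mulrBl.
have gE : lam' k - lam' k.+1 = g by rewrite /g /lam' mulrBl.
have gom : g <= om.
  rewrite ler_pM2r //; have a := lam_k_1 k0 kn hlam.
  have b : lam n <= lam k.+1 by exact: hlam.
  by clear - a b; lra.
have omL : om <= L by rewrite ler_pM2r // gerBl.
have g0 : 0 <= g by clear - g49; lra.
have o0 : 0 <= om by exact: le_trans gom.
have L0 : 0 <= L by exact: le_trans omL.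
have F2 : F0 ^+ 2 <= F ^+ 2 by rewrite ler_sqr ?nnegrE ?frobnorm_ge0.
have F3 : F0 ^+ 3 <= F ^+ 3 by rewrite lerXn2r ?nnegrE ?frobnorm_ge0.
have s1' : L ^+ 2 * F0 ^+ 3 <= d ^+ 3.
  by apply: le_trans s1; rewrite ler_wpM2l ?sqr_ge0.
have s2' : L * om * F0 ^+ 2 <= d ^+ 2 * g ^+ 2.
  by apply: le_trans s2; rewrite ler_wpM2l // mulr_ge0.
have [[Fs Bs LFs LBs] [oFs oF2s gps]] := small_params F00 g49 gom omL s1' s2'.
pose gp := g - om * F0 ^+ 2; pose B := 9 / 2 * F0 + 75 * (om * F0 ^+ 2).
rewrite -/gp -/B in Bs LBs oFs gps.
have muE i : mu i = dot (col i uhat) (A *m col i uhat).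
  by rewrite (Amu i i) eqxx mulr1.
have [z [zp zeq zproj [D u'E]]] := epsi_vectors muE step.
pose E := eta^-1 *: (A - Ahat).
have Ebd y : dot y y <= dot y (E *m y) <= 3 * dot y y.
  have up := psdmx_dot y hupp; have lo := psdmx_dot y hlow.
  have eE : dot y (A *m y) - dot y (Ahat *m y) = eta * dot y (E *m y).
    rewrite /E -scalemxAl dotZr mulrA divff ?mul1r ?gt_eqF //.
    by rewrite mulmxBl dotBr.
  rewrite !mulmxBl mul_scalar_mx !dotBr dotZr in up.
  rewrite !mulmxBl mul_scalar_mx !dotBr dotZr in lo.
  have c : 0 <= eta * dot y (E *m y) - eta * dot y y <= 2 * eta * dot y y.
    rewrite -eE; move: (dot y (A *m y)) (dot y (Ahat *m y)) (dot y y) up lo.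
    by clear => a b c up lo; apply/andP; split; lra.
  move: c; move: (dot y (E *m y)) (dot y y); clear - eta0 => a b /andP[c1 c2].
  by apply/andP; split; rewrite -(ler_pM2l eta0); lra.
have rE i : resid (specA V lam') uh lh i = specA V lam' *m uh i - lh i *: uh i by [].
have hyps : sweep (specA V lam') E (specJ k V) uh z lh F0 L om gp B.
  split=> //.
  - exact: spec_sym.
  - by rewrite /E linearZ /= linearB /= A_sym hAhat.
  - exact: spec_sym.
  - exact: sqr_specJ.
  - exact: spec_comm.
  - move=> y; apply/andP; split.
      rewrite AE -scalemxAl dotZr; apply: mulr_ge0; first exact: ltW.
      exact: psdmx_dot.
    by apply: spec_quad_le => // j; exact: (lam_le1 hlam').
  - move=> i y; rewrite -omE; apply: (specJ_form hV hlam' uh_on Auh).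
    have a := ritz_gek k0 kn hV hlam' uh_on Auh FE i.
    by rewrite omE in a; rewrite /gp -gE; clear - a; lra.
  - move=> i j; rewrite rE dotBr dotZr Auh uh_on; exact: subrr.
  - move=> i; rewrite -omE; apply: (resid_bound k0 kn hV hlam' uh_on Auh F00 FE).
    by clear - Fs; lra.
  - move=> i; rewrite (ritz_le1 hV hlam' uh_on Auh) andbT.
    apply: le_trans (ritz_gen hV hlam' uh_on Auh i).
    by rewrite divr_ge0 // ltW.
  - move=> i y py; rewrite -omE.
    exact: (ritz_rayleigh k0 kn hV hlam' uh_on Auh lh_dec FE py).
  - apply: l2_le => //; rewrite -FE; apply: ler_sum => j _.
    by rewrite sqr_nrm.
  - move=> i y py; have := zeq i y py; rewrite -/(uh i) => q.
    rewrite /hvec; set v := uh i + z i in q *.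
    rewrite AE /E -!scalemxAl !dotZr /lh -[RHS](mulr0 eta^-1) -q.
    by ring.
  - by clear - gps g49; lra.
have [Jh low] := sweep_bound hyps.
set H := \matrix_(a, j) _ in u'E.
have Hcol j : col j H = hvec uh z j by apply/matrixP => a b; rewrite !mxE (ord1 b).
(* The columns of [H] are only nearly orthonormal: the lower bound 1 - B on its singular values
   yields |C| <= 1 / (1 - B). *)
have [C UE] : exists C, Uq1 = H *m C.
  have [D' ->] : exists D', Uq1 = u' *m D'.
    by apply: submx_tr_mul; case: hUq1 => _ /andP[].
  by exists (D *m D'); rewrite u'E mulmxA.
have B1 : 0 < 1 - B by clear - Bs; lra.
have oUq1 : orthonormal_cols Uq1 by case: hUq1.
have Cle x : nrm (C *m x) <= (1 - B)^-1 * nrm x.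
  rewrite -ler_pdivrMl ?invr_gt0 // invrK.
  have := low (fun l => (C *m x) l 0).
  have -> : \sum_l (C *m x) l 0 *: hvec uh z l = Uq1 *m x.
    rewrite UE -mulmxA (mul_sum_col H); apply: eq_bigr => l _; by rewrite Hcol.
  have -> : nrm (Uq1 *m x) = nrm x.
    by rewrite !nrmE /dot trmx_mul mulmxA -(mulmxA _ Uq1^T) oUq1 mulmx1.
  apply: le_trans; rewrite ler_pM2l // l2_nrm.
have HF : frobnorm (V2^T *m H) <= 501 / 500 * B / gp + 101 / 100 * F0 * B.
  apply: le_trans Jh; rewrite -ler_sqr ?nnegrE ?frobnorm_ge0 ?l2_ge0 //.
  rewrite sqr_frobnorm_cols // sqr_l2; apply: ler_sum => j _.
  by rewrite Hcol sqr_nrm.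
have UF : frobnorm (V2^T *m Uq1) <= (1 - B)^-1 * frobnorm (V2^T *m H).
  by rewrite UE; apply: frobnorm_cols_mul => //; rewrite invr_ge0 ltW.
have gpos : 0 < g by clear - g49; lra.
have gppos : 0 < gp by clear - gps gpos; lra.
have f00 : 0 <= om * F0 ^+ 2 by rewrite mulr_ge0 ?sqr_ge0.
have B0 : 0 <= B by rewrite /B; clear - F00 f00; lra.
set X := frobnorm _ in UF *.
have X0 : 0 <= X by exact: frobnorm_ge0.
have XB : X * (999 / 10 ^+ 3) <= 501 / 500 * (B / gp) + 101 / 100 * (F0 * B).
  apply: le_trans (_ : X * (1 - B) <= _).
    by rewrite ler_wpM2l //; clear - Bs; lra.
  rewrite -ler_pdivlMr // mulrC; apply: le_trans UF _.
  rewrite ler_wpM2l ?invr_ge0 ?(ltW B1) //; clear - HF; lra.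
have y1 : B / gp <= 10 ^+ 3 / 999 * (B / g).
  rewrite ler_pdivrMr //.
  have a := ler_wpM2l (divr_ge0 B0 g0) gps.
  have b : B / g * g = B by rewrite divfK // gt_eqF.
  by clear - a b; lra.
have y2 : B / g = 9 / 2 * (F0 / g) + 75 * (om * F0 ^+ 2 / g) by rewrite /B; ring.
have y3 : F0 * B = 9 / 2 * F0 ^+ 2 + 75 * (F0 * (om * F0 ^+ 2)) by rewrite /B; ring.
have a0 : F0 / g <= F / g by rewrite ler_pM2r // invr_gt0.
have f1 : om * F0 ^+ 2 <= om * F ^+ 2 by rewrite ler_wpM2l.
have a1 : om * F0 ^+ 2 / g <= om * F ^+ 2 / g by rewrite ler_pM2r // invr_gt0.
have a2 : F0 * (om * F0 ^+ 2) <= F * (om * F ^+ 2) by rewrite ler_pM.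
have a00 : 0 <= F0 / g by rewrite divr_ge0.
have a10 : 0 <= om * F0 ^+ 2 / g by rewrite divr_ge0.
have a20 : 0 <= F0 * (om * F0 ^+ 2) by rewrite mulr_ge0.
have F20 := sqr_ge0 F0.
rewrite y2 in y1; rewrite y3 in XB.
clear - X0 XB y1 a0 a1 a2 F2 a00 a10 a20 F20.
move: (B / gp) (F0 / g) (om * F0 ^+ 2 / g) (F0 ^+ 2) (F0 * (om * _)) (F / g)
  (om * F ^+ 2 / g) (F ^+ 2) (F * (om * F ^+ 2))
  X0 XB y1 a0 a1 a2 F2 a00 a10 a20 F20 => *.
lra.
Qed.

(** * Choice of the constants and separation of the trivial regimes *)

Lemma sqrt2_ge (R : realType) : 7 / 5 <= Num.sqrt (2 : R).
Proof.
have e := sqr_sqrtr (ler0n R 2); have s := sqrtr_ge0 (2 : R).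
by rewrite -ler_sqr ?nnegrE ?e //; lra.
Qed.

Theorem theorem2p4 (R : realType) :
  exists c : R, 0 < c /\
  exists c1 : R -> R, (forall k : nat, (0 < k)%N -> 0 < c1 (Num.sqrt k%:R)) /\
  forall (n k : nat) (hk : (0 < k)%N) (hkn : (k < n)%N)
    (A Ahat V : 'M[R]_n) (lam : nat -> R)
    (* lam i is the i-th eigenvalue, numbered from 1 *)
    (hA : psdmx A)
    (hV : orthonormal_cols V)
    (hAV : A = V *m diag_mx (\row_(j < n) lam j.+1) *m V^T)
    (hlam : forall i j : nat,
       (1 <= i)%N -> (i <= j)%N -> (j <= n)%N -> lam j <= lam i)
    (hAhat : Ahat^T = Ahat)
    (eta : R)
    (heta0 : 0 < eta)
    (heta : eta < (lam k - lam k.+1) / (7 / 2 * Num.sqrt 2))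
    (hlow : loewner (A - (3 * eta)%:M) Ahat)
    (hupp : loewner Ahat (A - eta%:M))
    (U0 : 'M[R]_(n, k))
    (hU0 : orthonormal_cols U0)
    (eps : R)
    (heps : eps < eta / (26 * (lam 1%N - eta)))
    (hinit : forall i : nat, (2 <= i)%N -> (i <= k)%N ->
       specnorm ((cols V i n)^T *m cols U0 1 i.-1) <= eps)
    (q : nat)
    (u : nat -> 'M[R]_(n, k))
    (hu0 : u 0%N = U0)
    (hiter : forall p : nat, (p <= q)%N -> lazy_epsi_iter A Ahat (u p) (u p.+1))
    (Uq Uq1 : 'M[R]_(n, k))
    (hUq : orthonormal_basis Uq (u q))
    (hUq1 : orthonormal_basis Uq1 (u q.+1)),
  let V2 := cols V k.+1 n in
  let c0 := 1 + c * lam 1%N * k%:R * specnorm (V2^T *m Uq) / eta in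
  let c2 := 17 * Num.sqrt (2 * k%:R) * c1 (Num.sqrt k%:R) * lam 1%N
              * (lam 1%N - lam n) / (lam k - lam k.+1) ^+ 2
            + 36 * lam 1%N / eta in
  frobnorm (V2^T *m Uq1) <=
    c0 * (7 / 2 * Num.sqrt 2 * lam k / (lam k - lam k.+1) * (eta / lam k)
            * frobnorm (V2^T *m Uq)
          + c2 * frobnorm (V2^T *m Uq) ^+ 2).
Proof.
pose t : R := 10 ^+ 5.
have t0 : 0 < t by rewrite exprn_gt0.
have t1 : 1 <= t by rewrite exprn_ege1 // ler1n.
(* [c] and [c1] are the reciprocals of the smallness thresholds (1/t)^3 for L^2 F^3 and (1/t)^2 for
   L om F^2 / g^2. *)
exists (t ^+ 3); split; first exact: exprn_gt0.
exists (fun=> t ^+ 2); split; first by move=> *; exact: exprn_gt0.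
move=> n k k0 kn A Ahat V lam hA hV hAV hlam hAhat eta eta0 heta hlow hupp.
move=> U0 _ eps _ _ q u _ hiter Uq Uq1 hUq hUq1; cbv zeta.
set V2 := cols V k.+1 n.
pose F := frobnorm (V2^T *m Uq).
pose L := lam 1%N / eta; pose om := (lam 1%N - lam n) / eta.
pose g := (lam k - lam k.+1) / eta.
pose rk : R := Num.sqrt k%:R.
have s2 := sqrt2_ge R.
have s20 : 0 < 7 / 2 * Num.sqrt (2 : R) by clear - s2; lra.
have g_gt : 7 / 2 * Num.sqrt 2 < g by rewrite ltr_pdivlMr // mulrC -ltr_pdivlMr.
have g49 : 49 / 10 <= g by clear - s2 g_gt; lra.
have gpos : 0 < g by clear - g49; lra.
have gap : 0 < lam k - lam k.+1 by rewrite -(pmulr_lgt0 _ (_ : 0 < eta^-1)) // invr_gt0.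
have n0 : 0 <= lam n.
  by apply: lam_n_ge0 hV _; [exact: leq_ltn_trans kn|rewrite /spec -hAV].
have nk1 : lam n <= lam k.+1 by exact: hlam.
have k11 := lam_k_1 k0 kn hlam.
have lamk : 0 < lam k by clear - gap n0 nk1; lra.
have ie0 : 0 < eta^-1 by rewrite invr_gt0.
have gom : g <= om by rewrite ler_pM2r //; clear - nk1 k11; lra.
have omL : om <= L by rewrite ler_pM2r // gerBl.
have om0 : 0 <= om by clear - gom gpos; lra.
have L0 : 0 <= L by clear - omL om0; lra.
have L1 : 1 <= L by clear - omL gom g49; lra.
have F0 : 0 <= F by exact: frobnorm_ge0.
have F20 := sqr_ge0 F.
have F30 : 0 <= F ^+ 3 by exact: exprn_ge0.
have rk1 : 1 <= rk by rewrite -[leLHS]sqrtr1 ler_wsqrtr // ler1n.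
have rk0 : 0 <= rk by exact: sqrtr_ge0.
pose Q := L * om / g ^+ 2.
pose r2k : R := Num.sqrt (2 * k%:R).
have rkr2k : rk <= r2k.
  by rewrite ler_wsqrtr // ler_peMl // ler1n.
pose T := 7 / 2 * Num.sqrt 2 * (F / g) + (17 * r2k * t ^+ 2 * Q + 36 * L) * F ^+ 2.
pose W := L * (k%:R * specnorm (V2^T *m Uq)).
apply: le_trans (_ : (1 + t ^+ 3 * W) * T <= _); last first.
  apply: eq_ler; rewrite /T /W /Q /L /om /g -/r2k -/F.
  by field; rewrite !gt_eqF.
have WF : L * (rk * F) <= W by rewrite ler_wpM2l // frobnorm_le_specnorm.
have W0 : 0 <= W by apply: le_trans WF; exact: mulr_ge0 L0 (mulr_ge0 rk0 F0).
have t20 : 0 <= t ^+ 2 by exact: sqr_ge0.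
have t30 : 0 <= t ^+ 3 by apply: exprn_ge0; exact: ltW.
have Q0 : 0 <= Q by apply: divr_ge0; [exact: mulr_ge0|exact: sqr_ge0].
have r2k0 : 0 <= r2k by exact: sqrtr_ge0.
have T1 : 0 <= 7 / 2 * Num.sqrt 2 * (F / g).
  by rewrite mulr_ge0 ?(ltW s20) // divr_ge0 // ltW.
have T2 : 0 <= 17 * r2k * t ^+ 2 * Q * F ^+ 2.
  by apply: mulr_ge0 => //; apply: mulr_ge0 => //; do 2 apply: mulr_ge0 => //.
have T3 : 0 <= 36 * L * F ^+ 2 by apply: mulr_ge0 => //; apply: mulr_ge0.
have TE : T = 7 / 2 * Num.sqrt 2 * (F / g) + 17 * r2k * t ^+ 2 * Q * F ^+ 2
   + 36 * L * F ^+ 2 by rewrite /T; ring.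
have T0 : 0 <= T by rewrite TE; clear - T1 T2 T3; lra.
have WT0 : 0 <= t ^+ 3 * W * T by do 2 apply: mulr_ge0 => //.
have cT : T <= (1 + t ^+ 3 * W) * T by clear - WT0; lra.
have oUq1 : orthonormal_cols Uq1 by case: hUq1.
have triv := frobnorm_cols_le k hV oUq1; rewrite -/rk in triv.
(* Above the first threshold, the correction in [c0] times the term 36 L F^2 of [c2] is at least 36
   sqrt k (t^3 L^2 F^3), which exceeds sqrt k. *)
have [S1|S1] := leP (L ^+ 2 * F ^+ 3) ((1 / t) ^+ 3); last first.
  apply: le_trans triv _.
  have a1 : rk <= 36 * rk * (t ^+ 3 * (L ^+ 2 * F ^+ 3)).
    have b1 : 1 <= t ^+ 3 * (L ^+ 2 * F ^+ 3).
      apply: ltW; rewrite -ltr_pdivrMl ?exprn_gt0 //.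
      by rewrite mulr1 -exprVn -[t^-1]div1r.
    by have := ler_wpM2l rk0 b1; clear - rk0; lra.
  have a2 : 36 * rk * (t ^+ 3 * (L ^+ 2 * F ^+ 3))
      = t ^+ 3 * (L * (rk * F)) * (36 * L * F ^+ 2) by ring.
  have a3 : t ^+ 3 * (L * (rk * F)) * (36 * L * F ^+ 2) <= t ^+ 3 * W * T.
    apply: ler_pM => //.
      by do 2 apply: mulr_ge0 => //; exact: mulr_ge0.
      by rewrite ler_wpM2l.
    by rewrite TE; clear - T1 T2; lra.
  by rewrite -a2 in a3; clear - a1 a3 T0; lra.
(* Above the second threshold, the [c1] term alone is at least 17 sqrt (2k). *)
have [S2|S2] := leP (L * om * F ^+ 2) ((1 / t) ^+ 2 * g ^+ 2); last first.
  apply: le_trans triv _; apply: le_trans cT; rewrite TE.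
  have a1 : 1 <= t ^+ 2 * Q * F ^+ 2.
    have -> : t ^+ 2 * Q * F ^+ 2 = t ^+ 2 * (L * om * F ^+ 2) / g ^+ 2.
      by rewrite /Q; ring.
    rewrite ler_pdivlMr ?exprn_gt0 // mul1r -ler_pdivrMl ?exprn_gt0 //.
    by apply: ltW; rewrite -exprVn -[t^-1]div1r.
  have a2 := ler_wpM2l r2k0 a1.
  have -> : 17 * r2k * t ^+ 2 * Q * F ^+ 2 = 17 * (r2k * (t ^+ 2 * Q * F ^+ 2)) by ring.
  by clear - a2 rkr2k T1 T3 rk0; lra.
apply: le_trans cT; apply: le_trans (iteration_bound k0 kn hA hV hAV hlam hAhat eta0
  hlow hupp (hiter q (leqnn q)) hUq hUq1 g49 S1 S2) _.
rewrite TE -/F -/om -/g.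
have Fg0 : 0 <= F / g by rewrite divr_ge0 // ltW.
have d1 : 47 / 10 * (F / g) <= 7 / 2 * Num.sqrt 2 * (F / g).
  by apply: ler_wpM2r => //; clear - s2; lra.
have og : 1 <= om / g by rewrite ler_pdivlMr // mul1r.
have QE : Q = om / g * (L / g) by rewrite /Q; field; rewrite gt_eqF.
have Lg : 1 <= L / g by rewrite ler_pdivlMr // mul1r (le_trans gom).
have Qog : om / g <= Q by rewrite QE ler_peMr // (le_trans ler01).
(* Since L / g and om / g are at least 1, [Q] dominates both om / g and 1. *)
have d2 : 80 * (om * F ^+ 2 / g) + 5 * F ^+ 2 <= 17 * r2k * t ^+ 2 * Q * F ^+ 2.
  have e1 : om * F ^+ 2 / g <= Q * F ^+ 2.
    by rewrite mulrAC ler_wpM2r.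
  have e2 : F ^+ 2 <= Q * F ^+ 2 by rewrite ler_peMl // (le_trans og).
  have e3 : 5 <= t ^+ 2.
    apply: le_trans (_ : (10 : R) ^+ 1 <= _); first by rewrite expr1 ler_nat.
    by rewrite /t -exprM; apply: ler_weXn2l => //; rewrite ler1n.
  have QF0 : 0 <= Q * F ^+ 2 by rewrite mulr_ge0.
  have e4 : 17 * 5 * (Q * F ^+ 2) <= 17 * (r2k * t ^+ 2) * (Q * F ^+ 2).
    rewrite ler_wpM2r // ler_wpM2l // (le_trans e3) // ler_peMl //.
    exact: le_trans rkr2k.
  clear - e1 e2 e4; lra.
have Fsmall : F <= 1 / 10.
  apply: le_trans (_ : 1 / t <= _).
    apply: ler_cube; first by rewrite divr_ge0 // ltW.
    by apply: le_trans S1; rewrite ler_peMl // exprn_ege1.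
  rewrite !div1r lef_pV2 ?posrE // -[leLHS]expr1.
  by apply: ler_weXn2l => //; rewrite ler1n.
(* The cubic term is absorbed by the second part of [c2], because om <= L and F <= 1/10. *)
have d3 : 80 * (F * (om * F ^+ 2)) <= 36 * L * F ^+ 2.
  have e1 : om * F ^+ 2 <= L * F ^+ 2 by rewrite ler_wpM2r.
  have e2 : 0 <= om * F ^+ 2 by rewrite mulr_ge0.
  have e3 := ler_pM F0 e2 Fsmall e1.
  have e4 : 0 <= L * F ^+ 2 by rewrite mulr_ge0.
  by clear - e3 e4; lra.
clear - d1 d2 d3; lra.
Qed.
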